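(* Let $(B,f)$ be a virtual biquandle, with operations $\circ,\ast$ on $B$, and define $$x\circ_f y=f^{-1}(x)\circ f^{-1}(y),\qquad x\ast_f y=f^{-1}(x)\ast f^{-1}(y).$$ 1. The set $B$ with the operations $\circ_f$ and $\ast_f$ is a biquandle (denoted $B_f$, the twisted biquandle). 2. For any oriented virtual link diagram $D$ there is a bijection between the set $Col_{(B,f)}(D)$ of colourings of $D$ with the virtual biquandle $(B,f)$ and the set $Col_{B_f}(D)$ of colourings of $D$ with the biquandle $B_f$.
   Context: A biquandle is a set $B$ with two binary operations $\circ,\ast$ such that: (1) $x\circ x=x\ast x$ for all $x$; (2) for every $y$ the maps $x\mapsto x\circ y$ and $x\mapsto x\ast y$ are invertible; (3) the map $(x,y)\mapsto(x\circ y,\,y\ast x)$ is a bijection of $B\times B$; (4) for all $x,y,z$: $(x\circ z)\circ(y\circ z)=(x\circ y)\circ(z\ast y)$, $(x\circ z)\ast(y\circ z)=(x\ast y)\circ(z\ast y)$, $(x\ast z)\ast(y\ast z)=(x\ast y)\ast(z\circ y)$. A virtual biquandle is a pair $(B,f)$ where $B$ is a biquandle and $f\colon B\to B$ is an automorphism (a bijection with $f(x\circ y)=f(x)\circ f(y)$, $f(x\ast y)=f(x)\ast f(y)$). An oriented virtual link diagram $D$ is a generic immersion of finitely many oriented circles into the oriented plane, each transversal double point being marked classical (with over/under information) or virtual. Long arcs are arcs between consecutive classical crossings (they may contain virtual crossings); short arcs are arcs between consecutive crossings, classical or virtual. A component without classical crossings is a closed long arc, and a component without any crossings is a closed short arc.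 Classical colouring rule: at a classical crossing each strand is cut by the other strand into a part lying on the left of the other (oriented) strand and a part lying on its right. If the left parts of the under- and over-strand are coloured $x$ and $y$ respectively, then the right part of the under-strand must be coloured $x\circ y$ and the right part of the over-strand $y\ast x$. Virtual colouring rule: when a strand is traversed along its orientation through a virtual crossing and its colour before the crossing is $x$, its colour after the crossing is $f(x)$ if the other strand crosses it from right to left, and $f^{-1}(x)$ if the other strand crosses it from left to right. $Col_{B}(D)$ for a biquandle $B$ is the set of maps from the long arcs of $D$ to $B$ satisfying the classical colouring rule at all classical crossings (virtual crossings are ignored). $Col_{(B,f)}(D)$ is the set of maps from the short arcs of $D$ to $B$ satisfying the classical rule (with the operations $\circ,\ast$ of $B$) at all classical crossings and the virtual rule at all virtual crossings. *)

(* Defs.v *)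
From mathcomp Require Import all_boot all_order all_algebra.
From mathcomp Require Import all_classical all_reals all_analysis.
Import Order.TTheory GRing.Theory Num.Theory.
Import numFieldNormedType.Exports.

Set Implicit Arguments.
Unset Strict Implicit.
Unset Printing Implicit Defensive.

Local Open Scope classical_set_scope.
Local Open Scope ring_scope.

Record is_biquandle (B : Type) (circ ast : B -> B -> B) : Prop := IsBiquandle {
  biq_diag : forall x, circ x x = ast x x;
  biq_circ_bij : forall y, bijective (fun x => circ x y);
  biq_ast_bij : forall y, bijective (fun x => ast x y);
  biq_swap_bij :
    bijective (fun p : B * B => (circ p.1 p.2, ast p.2 p.1));
  biq_circ_circ : forall x y z,
    circ (circ x z) (circ y z) = circ (circ x y) (ast z y);
  biq_circ_ast : forall x y z,
    ast (circ x z) (circ y z) = circ (ast x y) (ast z y);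
  biq_ast_ast : forall x y z,
    ast (ast x z) (ast y z) = ast (ast x y) (circ z y)
}.

(* [finv] names the two-sided inverse of the bijection [f]. *)
Record is_virtual_biquandle (B : Type) (circ ast : B -> B -> B)
    (f finv : B -> B) : Prop := IsVirtualBiquandle {
  vbiq_biquandle : is_biquandle circ ast;
  vbiq_fK : cancel f finv;
  vbiq_finvK : cancel finv f;
  vbiq_circ : forall x y, f (circ x y) = circ (f x) (f y);
  vbiq_ast : forall x y, f (ast x y) = ast (f x) (f y)
}.

Definition twist (B : Type) (finv : B -> B) (op : B -> B -> B) : B -> B -> B :=
  fun x y => op (finv x) (finv y).

(* Oriented area of the parallelogram (u, v): positive exactly when v points
   to the left of u. *)
Definition det2 (R : realType) (u v : R * R) : R := u.1 * v.2 - u.2 * v.1.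

Definition velocity (R : realType) (g : R -> R * R) (t : R) : R * R :=
  (derive1 (fst \o g) t, derive1 (snd \o g) t).

(* C^1 immersion of the circle R/Z, oriented by increasing parameter. *)
Record circle_immersion (R : realType) (g : R -> R * R) : Prop :=
  CircleImmersion {
  imm_periodic : forall t, g (t + 1) = g t;
  imm_derivable1 : forall t, derivable (fst \o g) t 1;
  imm_derivable2 : forall t, derivable (snd \o g) t 1;
  imm_continuous1 : continuous (derive1 (fst \o g));
  imm_continuous2 : continuous (derive1 (snd \o g));
  imm_regular : forall t, velocity g t != (0, 0)
}.

(* Pairs (i, t) are points of a disjoint union of n circles R/Z, the parameter
   t being taken modulo the integers. *)
Definition same_point (R : realType) (n : nat) (p q : 'I_n * R) : Prop :=
  p.1 = q.1 /\ exists z : int, q.2 = p.2 + z%:~R.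

(* The double points are indexed by 'I_ncross. [strand k b] is the point of the
   source circles at which one of the two strands passes through crossing k: at
   a classical crossing [b = false] is the under-strand and [b = true] the
   over-strand; at a virtual crossing the labelling has no meaning. *)
Record vlink_diagram (R : realType) : Type := VLinkDiagram {
  ncomp : nat;
  curve : 'I_ncomp -> R -> R * R;
  ncross : nat;
  strand : 'I_ncross -> bool -> 'I_ncomp * R;
  virtual : 'I_ncross -> bool;
  curve_immersion : forall i, circle_immersion (curve i);
  (* each point of the source lies over at most one crossing, hence there are
     no triple points *)
  strand_inj : forall k b k' b',
    same_point (strand k b) (strand k' b') -> k = k' /\ b = b';
  curve_eq : forall p q : 'I_ncomp * R,
    curve p.1 p.2 = curve q.1 q.2 <->
    same_point p q \/
    exists k b, same_point (strand k b) p /\ same_point (strand k (~~ b)) q;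
  strand_transversal : forall k,
    det2 (velocity (curve (strand k false).1) (strand k false).2)
         (velocity (curve (strand k true).1) (strand k true).2) != 0
}.

Section Arcs.
Context {R : realType} (D : vlink_diagram R).

Definition source_point : Type := ('I_(ncomp D) * R)%type.

Definition strand_velocity (k : 'I_(ncross D)) (b : bool) : R * R :=
  velocity (curve (strand k b).1) (strand k b).2.

Definition is_cut (K : pred 'I_(ncross D)) (p : source_point) : Prop :=
  exists k b, K k /\ same_point (strand k b) p.

(* q is reached from p along the circle, in either direction, without meeting a
   crossing of K (possibly after several turns around an uncut circle). *)
Definition same_arc (K : pred 'I_(ncross D)) (p q : source_point) : Prop :=
  p.1 = q.1 /\
  exists z : int, forall t : R,
    Num.min p.2 (q.2 + z%:~R) <= t <= Num.max p.2 (q.2 + z%:~R) ->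
    ~ is_cut K (p.1, t).

(* An arc between consecutive crossings of K, as the set of its points, its end
   crossings excluded; a circle with no crossing of K is a single closed arc. *)
Definition arcs (K : pred 'I_(ncross D)) : set (set source_point) :=
  [set A | exists p, ~ is_cut K p /\ A = [set q | same_arc K p q]].

Definition arc_type (K : pred 'I_(ncross D)) : Type :=
  {A : set source_point | arcs K A}.

Definition is_classical : pred 'I_(ncross D) := fun k => ~~ virtual k.

Definition long_arc : Type := arc_type is_classical.
Definition short_arc : Type := arc_type predT.

Definition arc_before (K : pred 'I_(ncross D)) (p : source_point)
    (A : arc_type K) : Prop :=
  \forall s \near p.2^'-, proj1_sig A (p.1, s).

Definition arc_after (K : pred 'I_(ncross D)) (p : source_point)
    (A : arc_type K) : Prop :=
  \forall s \near p.2^'+, proj1_sig A (p.1, s).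

(* Strand b leaves crossing k on the left of the other strand exactly when its
   velocity points to the left of the velocity of the other strand. *)
Definition left_part (K : pred 'I_(ncross D)) (k : 'I_(ncross D)) (b : bool)
    (A : arc_type K) : Prop :=
  if 0 < det2 (strand_velocity k (~~ b)) (strand_velocity k b)
  then arc_after (strand k b) A else arc_before (strand k b) A.

Definition right_part (K : pred 'I_(ncross D)) (k : 'I_(ncross D)) (b : bool)
    (A : arc_type K) : Prop :=
  if 0 < det2 (strand_velocity k (~~ b)) (strand_velocity k b)
  then arc_before (strand k b) A else arc_after (strand k b) A.

Definition classical_rule (B : Type) (circ ast : B -> B -> B)
    (K : pred 'I_(ncross D)) (c : arc_type K -> B) : Prop :=
  forall k, is_classical k ->
  forall under_l under_r over_l over_r : arc_type K,
    left_part k false under_l -> right_part k false under_r ->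
    left_part k true over_l -> right_part k true over_r ->
    c under_r = circ (c under_l) (c over_l) /\
    c over_r = ast (c over_l) (c under_l).

(* The other strand crosses strand b from right to left exactly when its
   velocity points to the left of that of strand b. *)
Definition virtual_rule (B : Type) (f finv : B -> B) (c : short_arc -> B) :
    Prop :=
  forall k, virtual k ->
  forall (b : bool) (before after : short_arc),
    arc_before (strand k b) before -> arc_after (strand k b) after ->
    c after =
      if 0 < det2 (strand_velocity k b) (strand_velocity k (~~ b))
      then f (c before) else finv (c before).

Definition biquandle_colouring (B : Type) (circ ast : B -> B -> B) : Type :=
  {c : long_arc -> B | classical_rule circ ast c}.

Definition virtual_biquandle_colouring (B : Type) (circ ast : B -> B -> B)
    (f finv : B -> B) : Type :=
  {c : short_arc -> B | classical_rule circ ast c /\ virtual_rule f finv c}.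

End Arcs.

(* Main.v *)
Require Import Defs.
From mathcomp Require Import all_boot all_order all_algebra.
From mathcomp Require Import all_classical all_reals all_analysis.
From mathcomp Require Import ring lra zify.
Import Order.TTheory GRing.Theory Num.Theory.
Import numFieldNormedType.Exports.

(** The axioms of the twisted biquandle follow from those of the given one,
    because the automorphism and its inverse commute with both operations
    ([twist_biquandle]).

    The bijection of colourings comes from an Alexander numbering of the plane:
    an integer function that grows by one when a strand of the diagram is
    crossed from its right to its left. It exists because the plane is simply
    connected; it is the winding number of the diagram. The index of a short arc
    is the value on its right. At any crossing, of value n, both strands have
    index n + 1 on their parts to the left of the other strand and n on their
    parts to the right of it ([idx_left], [idx_right]).

    Replace the colour c(a) of each short arc a by f^i(c(a)), i being the index
    of a. The virtual rule says exactly that the result does not change at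
    virtual crossings, so that it is a colouring of long arcs
    ([untwisted_long]). At a classical crossing, with left parts x and y, the
    right part x o y becomes
    f^n(x o y) = f^-1(f^(n+1)(x)) o f^-1(f^(n+1)(y)),
    the twisted product of the new colours of the left parts ([fpow_twist]), and
    similarly for the other operation. The inverse map applies f^-i to the
    colour of the long arc that contains a.

    The numbering is obtained without integrals, from the local behaviour of the
    curves only. Near a point, a strand of an immersed curve is the graph of a
    function with a small Lipschitz constant, so that its neighbourhood splits
    into a left side, a right side and the strand itself ([strand_cover],
    [side_exclusive]). Counting the strands through p that have r on their left
    prescribes the change of the numbering from p to each nearby r. These
    prescriptions agree for neighbouring points ([jump_germ_cocycle]), and
    functions with compatible prescribed local changes can be glued over a
    rectangle, one edge at a time ([numbering_exists]). *)

Set Implicit Arguments.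
Unset Strict Implicit.
Unset Printing Implicit Defensive.

Local Open Scope classical_set_scope.
Local Open Scope ring_scope.

(** * Local-to-global on an interval *)

(** Compactness of a segment in the form of an induction principle. It replaces
    subdivision into small pieces, both for gluing along an interval and for
    showing that a locally constant function is constant. *)
Lemma interval_chain (R : realType) (P : R -> R -> Prop) (a b : R) :
  a <= b ->
  (forall x y z, a <= x -> x <= y -> y <= z -> z <= b ->
     P x y -> P y z -> P x z) ->
  (forall x, a <= x <= b -> exists2 e : R, 0 < e &
     forall y z, a <= y -> y <= z -> z <= b ->
       `|y - x| < e -> `|z - x| < e -> P y z) ->
  P a b.
Proof.
move=> ab Ptrans Ploc.
pose S := [set x | a <= x <= b /\ P a x].
have Sa : S a.
  split; first by rewrite lexx.
  have [|e e0] := Ploc a; first by rewrite lexx.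
  by apply; rewrite ?subrr ?normr0.
have supS : has_sup S by split; [exists a|exists b => x [/andP[]]].
pose s := sup S.
have asb : a <= s <= b.
  apply/andP; split; first exact: (ub_le_sup supS.2).
  by apply: ge_sup; [exists a|move=> x [/andP[]]].
have [e e0 Ps] := Ploc s asb.
have [x [/andP[ax xb] Pax] sx] := sup_adherent e0 supS.
have xs : x <= s by apply: (ub_le_sup supS.2); split=> //; rewrite ax.
(* the sup of the reachable points can be passed by half of its own radius e *)
pose m := Num.min b (s + e / 2).
have sm : s <= m by rewrite le_min; apply/andP; split; lra.
have mb : m <= b by rewrite ge_min lexx.
have mse : m <= s + e / 2 by rewrite ge_min lexx orbT.
have Pam : P a m.
  apply: (Ptrans a x m) => //; first lra.
  rewrite -/s in sx.
  by apply: Ps; rewrite ?ltr_norml//; try (apply/andP; split); lra.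
have ms : m <= s by apply: (ub_le_sup supS.2); split=> //; apply/andP; split; lra.
suff -> : b = m by [].
move: ms; rewrite /m /Num.min; case: ifP => // _; lra.
Qed.

Lemma near_dist (R : realType) (t : R) (P : R -> Prop) : (\forall s \near t, P s) ->
  exists2 e : R, 0 < e & forall s, `|s - t| < e -> P s.
Proof.
move=> /nbhs_ballP[e /= e0 he]; exists e => // s st.
by apply: he; rewrite /ball /= distrC.
Qed.

(** * Gluing functions with prescribed local changes over a rectangle *)

Section Gluing.
Context {R : realType}.
Implicit Types (J : R * R -> R * R -> int) (K : set (R * R)) (W : R * R -> int).

(** [J p r] is the change of value from [p] to a nearby [r] that is prescribed for
    the function to be found. The condition says that the prescriptions at
    neighbouring points are compatible, so that [J p] itself is a solution near
    [p]; gluing these solutions is a problem about a locally constant sheaf. *)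
Definition germ_cocycle J := forall p, \forall q \near p, \forall r \near q,
  J p r = J p q + J q r.

Definition numbering J K W := forall p, K p ->
  \forall r \near p, K r -> W r = W p + J p r.

Definition rect (a b c d : R) : set (R * R) :=
  [set p | a <= p.1 <= b /\ c <= p.2 <= d].

Lemma rect_closed a b c d : closed (rect a b c d).
Proof.
have -> : rect a b c d = (fst @^-1` `[a, b]) `&` (snd @^-1` `[c, d]).
  by apply/seteqP; split=> p /=; rewrite /rect /= !in_itv.
apply: closedI; apply: closed_comp => [p _|]; rewrite ?set_itvE;
  [exact: cvg_fst|exact: itv_closed|exact: cvg_snd|exact: itv_closed].
Qed.

Lemma numbering_sub J K K' W : K' `<=` K -> numbering J K W ->
  numbering J K' W.
Proof.
by move=> sub nW p /sub /nW; apply: filterS => r h /sub.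
Qed.

Lemma numbering_shift J K W z : numbering J K W ->
  numbering J K (fun p => W p + z).
Proof.
move=> nW p Kp; near=> r => Kr; rewrite addrAC; congr (_ + _).
by move: Kr; near: r; exact: nW.
Unshelve. all: by end_near. Qed.

(** Two solutions have the same prescribed changes, so that their difference is
    locally constant. *)
Lemma numbering_diff_const J K1 K2 W1 W2 (h : R -> R * R) (a b : R) :
  numbering J K1 W1 -> numbering J K2 W2 -> continuous h -> a <= b ->
  (forall t, a <= t <= b -> K1 (h t) /\ K2 (h t)) ->
  W1 (h a) - W2 (h a) = W1 (h b) - W2 (h b).
Proof.
move=> n1 n2 ch ab hK.
apply: (interval_chain (P := fun s t =>
  W1 (h s) - W2 (h s) = W1 (h t) - W2 (h t))) => //.
  by move=> x y z _ _ _ _ ->.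
move=> x xab; have [K1x K2x] := hK _ xab.
have : \forall t \near x, a <= t <= b ->
    W1 (h t) - W2 (h t) = W1 (h x) - W2 (h x).
  have h1 : \forall t \near x, K1 (h t) -> W1 (h t) = W1 (h x) + J (h x) (h t).
    exact: ch x _ (n1 _ K1x).
  have h2 : \forall t \near x, K2 (h t) -> W2 (h t) = W2 (h x) + J (h x) (h t).
    exact: ch x _ (n2 _ K2x).
  by apply: filterS2 h1 h2 => t h1 h2 /hK[/h1 -> /h2 ->]; ring.
move=> /nbhs_ballP[e /= e0 he]; exists e => // y z ay yz zb yx zx.
rewrite (he y) ?(he z)// ?/ball /= 1?distrC //; apply/andP; split=> //; lra.
Qed.

Lemma numbering_glue J K1 K2 W1 W2 : closed K1 -> closed K2 ->
  numbering J K1 W1 -> numbering J K2 W2 ->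
  (forall p, K1 p -> K2 p -> W1 p = W2 p) ->
  exists W, numbering J (K1 `|` K2) W.
Proof.
move=> cl1 cl2 n1 n2 e12.
pose W p := if p \in K1 then W1 p else W2 p.
have WE1 p : K1 p -> W p = W1 p by move=> ?; rewrite /W mem_set.
have WE2 p : K2 p -> W p = W2 p.
  by rewrite /W; case: ifPn => // /set_mem; exact: e12.
have away K p : closed K -> ~ K p -> \forall r \near p, ~ K r.
  by move=> clK Kp; apply: (closed_openC clK).
exists W => p Kp.
have [K1p|K1p] := pselect (K1 p); have [K2p|K2p] := pselect (K2 p).
- have := n1 _ K1p; have := n2 _ K2p; apply: filterS2 => r h2 h1 [Kr|Kr].
    by rewrite !WE1// h1.
  by rewrite !WE2// h2.
- have := n1 _ K1p; have := away _ _ cl2 K2p; apply: filterS2 => r h2 h1 [Kr|//].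
  by rewrite !WE1// h1.
- have := n2 _ K2p; have := away _ _ cl1 K1p; apply: filterS2 => r h1 h2 [//|Kr].
  by rewrite !WE2// h2.
- by case: Kp.
Qed.

(** Over a connected overlap the two solutions differ by one constant, which a
    shift of the second one removes. *)
Lemma numbering_glue_segment J K1 K2 W1 W2 (h : R -> R * R) (a b : R) :
  closed K1 -> closed K2 -> numbering J K1 W1 -> numbering J K2 W2 ->
  continuous h -> a <= b ->
  (forall p, K1 p /\ K2 p <-> exists2 t, a <= t <= b & p = h t) ->
  exists W, numbering J (K1 `|` K2) W.
Proof.
move=> cl1 cl2 n1 n2 ch ab K12.
have Kh t : a <= t <= b -> K1 (h t) /\ K2 (h t).
  by move=> tab; apply/K12; exists t.
pose z := W1 (h a) - W2 (h a).
apply: (numbering_glue cl1 cl2 n1 (numbering_shift z n2)) => p K1p K2p.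
have [t /andP[at_ tb] ->] : exists2 t, a <= t <= b & p = h t by apply/K12.
have := numbering_diff_const n1 n2 ch at_.
rewrite /z => -> => [|s /andP[as_ st]]; first ring.
by apply: Kh; rewrite as_ (le_trans st).
Qed.

(** A rectangle is simply connected: small squares carry the solutions [J p];
    these are stacked into thin vertical strips, and the strips side by side.
    Each gluing is along one edge, hence along a connected set. *)
Lemma numbering_exists J a b c d : germ_cocycle J -> a <= b -> c <= d ->
  exists W, numbering J (rect a b c d) W.
Proof.
move=> coJ ab cd.
apply: (interval_chain (P := fun x y =>
  exists W, numbering J (rect x y c d) W)) => //.
  move=> x y z _ xy yz _ [W1 n1] [W2 n2].
  have [||||W nW] := numbering_glue_segment (h := fun t => (y, t)) _ _ n1 n2 _ cd.
  - exact: rect_closed.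
  - exact: rect_closed.
  - by move=> t; exact: (cvg_pair (cvg_cst y) cvg_id).
  - move=> [p1 p2]; rewrite /rect /=; split=> [[[/andP[? ?] ?] [/andP[? ?] ?]]|].
      by exists p2 => //; congr (_, _); lra.
    by move=> [t tcd [-> ->]]; rewrite !lexx xy yz.
  exists W; apply: numbering_sub nW => -[p1 p2]; rewrite /rect /= => -[/andP[? ?] ?].
  by have [|] := leP p1 y => ?; [left|right]; split=> //; apply/andP; split; lra.
move=> x xab.
suff [e e0 [W nW]] : exists2 e : R, 0 < e &
    exists W, numbering J (rect (x - e) (x + e) c d) W.
  exists e => // y z _ yz _; rewrite !ltr_norml => /andP[? ?] /andP[? ?].
  exists W; apply: numbering_sub nW => -[p1 p2]; rewrite /rect /= => -[/andP[? ?] ?].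
  by split=> //; apply/andP; split; lra.
apply: (interval_chain (P := fun u v => exists2 e : R, 0 < e &
    exists W, numbering J (rect (x - e) (x + e) u v) W)) => //.
  move=> u y v _ uy yv _ [e1 e10 [W1 n1]] [e2 e20 [W2 n2]].
  pose e := Num.min e1 e2.
  have e0 : 0 < e by rewrite lt_min e10.
  have ee1 : e <= e1 by rewrite ge_min lexx.
  have ee2 : e <= e2 by rewrite ge_min lexx orbT.
  exists e => //.
  have {}n1 : numbering J (rect (x - e) (x + e) u y) W1.
    apply: numbering_sub n1 => p [/andP[? ?] ?].
    by split=> //; apply/andP; split; lra.
  have {}n2 : numbering J (rect (x - e) (x + e) y v) W2.
    apply: numbering_sub n2 => p [/andP[? ?] ?].
    by split=> //; apply/andP; split; lra.
  have le : x - e <= x + e by lra.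
  have [||||W nW] := numbering_glue_segment (h := fun t => (t, y)) _ _ n1 n2 _ le.
  - exact: rect_closed.
  - exact: rect_closed.
  - by move=> t; exact: (cvg_pair cvg_id (cvg_cst y)).
  - move=> [p1 p2]; rewrite /rect /=; split=> [[[? /andP[? ?]] [? /andP[? ?]]]|].
      by exists p1 => //; congr (_, _); lra.
    by move=> [t tcd [-> ->]]; rewrite !lexx uy yv.
  exists W; apply: numbering_sub nW => -[p1 p2]; rewrite /rect /= => -[? /andP[? ?]].
  by have [|] := leP p2 y => ?; [left|right]; split=> //; apply/andP; split; lra.
move=> y _; have /nbhs_ballP[e /= e0 he] := coJ (x, y).
exists e => // u v _ uv _; rewrite !ltr_norml => /andP[? ?] /andP[? ?].
exists (e / 2); first lra.
exists (J (x, y)) => -[p1 p2] [/= /andP[? ?] /andP[? ?]].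
apply: filterS (he (p1, p2) _) => [r -> //|].
by split; rewrite /ball /= ltr_norml; apply/andP; split; lra.
Qed.

End Gluing.

(** * Immersed curves as Lipschitz graphs *)

Definition dot (R : realType) (u v : R * R) : R := u.1 * v.1 + u.2 * v.2.

Lemma dotB (R : realType) (v a b : R * R) : dot v (a - b) = dot v a - dot v b.
Proof. by rewrite /dot /=; ring. Qed.

Lemma det2B (R : realType) (v a b : R * R) : det2 v (a - b) = det2 v a - det2 v b.
Proof. by rewrite /det2 /=; ring. Qed.

Section Strand.
Context {R : realType} (g : R -> R * R) (gI : circle_immersion g).
Implicit Types (s t d k : R) (r : R * R).

Lemma immersion_cont1 : continuous (fun t => (g t).1).
Proof.
by move=> t; apply: differentiable_continuous; apply/derivable1_diffP;
  exact: (imm_derivable1 gI).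
Qed.

Lemma immersion_cont2 : continuous (fun t => (g t).2).
Proof.
by move=> t; apply: differentiable_continuous; apply/derivable1_diffP;
  exact: (imm_derivable2 gI).
Qed.

Lemma immersion_cont : continuous g.
Proof.
move=> t; have h := cvg_pair (@immersion_cont1 t) (@immersion_cont2 t).
rewrite (_ : g = (fun t => ((g t).1, (g t).2))); first exact: h.
by apply/funext => u; case: (g u).
Qed.

Lemma linear_form_is_derive (p q t : R) :
  is_derive t 1 (fun t => p * (g t).1 + q * (g t).2)
    (p * (velocity g t).1 + q * (velocity g t).2).
Proof.
have d1 : is_derive t 1 (fst \o g) (velocity g t).1.
  rewrite /velocity !derive1E /=; apply/derivableP.
  exact: (@imm_derivable1 _ _ gI t).
have d2 : is_derive t 1 (snd \o g) (velocity g t).2.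
  rewrite /velocity !derive1E /=; apply/derivableP.
  exact: (@imm_derivable2 _ _ gI t).
exact: (is_deriveD (is_deriveZ p d1) (is_deriveZ q d2)).
Qed.

(** The mean value theorem fails for plane curves but holds for each linear form
    of the curve; every estimate on strands is obtained from it. *)
Lemma linear_form_MVT (p q s s' : R) : s < s' ->
  exists2 c, s < c < s' & p * (g s' - g s).1 + q * (g s' - g s).2 =
    (p * (velocity g c).1 + q * (velocity g c).2) * (s' - s).
Proof.
move=> ss'; pose h := (fun t => p * (g t).1 + q * (g t).2).
have dh t := linear_form_is_derive p q t.
have [|c + hc] := @MVT _ h _ s s' ss' (fun t _ => dh t).
  by apply: derivable_within_continuous => x _; case: (dh x).
rewrite in_itv /= => cs; exists c => //.
by rewrite -hc /h /=; ring.
Qed.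

Lemma dot_velocity_gt0 t : 0 < dot (velocity g t) (velocity g t).
Proof.
have := @imm_regular _ _ gI t; case: (velocity g t) => x y; rewrite /dot /= => n0.
rewrite lt_neqAle addr_ge0 ?sqr_ge0 ?andbT -?expr2 ?sqr_ge0//.
rewrite eq_sym paddr_eq0 ?sqr_ge0// !sqrf_eq0.
by apply: contra n0 => /andP[/eqP -> /eqP ->].
Qed.

Lemma near_velocity_gt0 t (p q : R) :
  0 < p * (velocity g t).1 + q * (velocity g t).2 ->
  \forall s \near t, 0 < p * (velocity g s).1 + q * (velocity g s).2.
Proof.
have c1 : {for t, continuous (fun s => (velocity g s).1)}.
  exact: @imm_continuous1 _ _ gI t.
have c2 : {for t, continuous (fun s => (velocity g s).2)}.
  exact: @imm_continuous2 _ _ gI t.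
have cl : {for t, continuous (fun s => p * (velocity g s).1 + q * (velocity g s).2)}.
  by apply: cvgD; apply: cvgM => //; exact: cvg_cst.
by move=> h; exact: (cl _ (lt_nbhsr h)).
Qed.

(** The direction of travel stays in the cone of slope [k] about the direction
    at [t]. *)
Definition straight t k d := forall s, `|s - t| < d ->
  0 < dot (velocity g t) (velocity g s) /\
  `|det2 (velocity g t) (velocity g s)| <=
    k * dot (velocity g t) (velocity g s).

Lemma straight_exists t k : 0 < k -> exists2 d, 0 < d & straight t k d.
Proof.
move=> k0; set v := velocity g t.
have v0 := dot_velocity_gt0 t; rewrite -/v in v0.
have kv0 := mulr_gt0 k0 v0.
have h0 := near_velocity_gt0 (t := t) v0.
have h1 := @near_velocity_gt0 t (k * v.1 + v.2) (k * v.2 - v.1).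
have h2 := @near_velocity_gt0 t (k * v.1 - v.2) (k * v.2 + v.1).
have {}h1 := h1 (eq_rect _ (fun z => 0 < z) kv0 _ _).
have {}h2 := h2 (eq_rect _ (fun z => 0 < z) kv0 _ _).
have : \forall s \near t, 0 < dot v (velocity g s) /\
  `|det2 v (velocity g s)| <= k * dot v (velocity g s).
  near=> s; split; first by near: s; exact: h0.
  have a1 : 0 < (k * v.1 + v.2) * (velocity g s).1 + (k * v.2 - v.1) * (velocity g s).2.
    by near: s; apply: h1; rewrite /dot; ring.
  have a2 : 0 < (k * v.1 - v.2) * (velocity g s).1 + (k * v.2 + v.1) * (velocity g s).2.
    by near: s; apply: h2; rewrite /dot; ring.
  by rewrite ler_norml /dot /det2; apply/andP; split; lra.
move=> /nbhs_ballP[d /= d0 hd]; exists d => // s sd.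
by apply: hd; rewrite /ball /= distrC.
Unshelve. all: by end_near. Qed.

Lemma straight_sub t k d d' : d' <= d -> straight t k d -> straight t k d'.
Proof. by move=> dd h s sd; apply: h; exact: lt_le_trans dd. Qed.

(** In the axes along and across the velocity at [t], a straight piece is the
    graph of a [k]-Lipschitz function: both linear forms [k * dot v _ + det2 v _]
    and [k * dot v _ - det2 v _] increase along it. *)
Lemma straight_lipschitz t k d s s' : straight t k d ->
  `|s - t| < d -> `|s' - t| < d ->
  `|det2 (velocity g t) (g s' - g s)| <= k * `|dot (velocity g t) (g s' - g s)|.
Proof.
move=> st; wlog ss' : s s' / s < s'.
  move=> hw sd s'd; have [ss'|ss'|->] := ltgtP s s'; first exact: (hw s s' ss' sd s'd).
    have := hw s' s ss' s'd sd.
    set v := velocity g t.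
    by rewrite !det2B !dotB distrC [in X in _ <= X -> _]distrC.
  by rewrite det2B dotB !subrr normr0 mulr0.
rewrite !ltr_norml => /andP[? ?] /andP[? ?].
set v := velocity g t.
have mono p q : (forall c, s < c < s' ->
    0 <= p * (velocity g c).1 + q * (velocity g c).2) ->
    0 <= p * (g s' - g s).1 + q * (g s' - g s).2.
  move=> h; have [c /h hc ->] := linear_form_MVT p q ss'.
  by apply: mulr_ge0 => //; lra.
have stc c : s < c < s' -> 0 < dot v (velocity g c) /\
    `|det2 v (velocity g c)| <= k * dot v (velocity g c).
  by move=> /andP[? ?]; apply: st; rewrite ltr_norml; apply/andP; split; lra.
have h0 := mono v.1 v.2 (fun c hc => ltW (stc c hc).1).
rewrite (ger0_norm h0).
have h1 : 0 <= (k * v.1 + v.2) * (g s' - g s).1 + (k * v.2 - v.1) * (g s' - g s).2.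
  apply: mono => c /stc[_]; rewrite ler_norml /det2 /dot => /andP[? ?]; lra.
have h2 : 0 <= (k * v.1 - v.2) * (g s' - g s).1 + (k * v.2 + v.1) * (g s' - g s).2.
  apply: mono => c /stc[_]; rewrite ler_norml /det2 /dot => /andP[? ?]; lra.
by rewrite ler_norml /det2 /dot; apply/andP; split; lra.
Qed.

Lemma linear_form_sides t (a b : R) :
  0 < a * (velocity g t).1 + b * (velocity g t).2 ->
  \forall s \near t,
    (t < s -> 0 < a * (g s - g t).1 + b * (g s - g t).2) /\
    (s < t -> a * (g s - g t).1 + b * (g s - g t).2 < 0).
Proof.
move=> h; have [e e0 he] := near_dist (near_velocity_gt0 h).
apply/nbhs_ballP; exists e => // s; rewrite /ball /= ltr_norml => /andP[s1 s2].
split=> ts.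
  have [c /andP[c1 c2] ->] := linear_form_MVT a b ts.
  apply: mulr_gt0; last lra.
  by apply: he; rewrite ltr_norml; apply/andP; split; lra.
have [c /andP[c1 c2] hc] := linear_form_MVT a b ts.
have c0 : 0 < a * (velocity g c).1 + b * (velocity g c).2.
  by apply: he; rewrite ltr_norml; apply/andP; split; lra.
have ts0 : 0 < t - s by lra.
by have := mulr_gt0 c0 ts0; rewrite -hc /=; lra.
Qed.

End Strand.

(** * The two sides of a strand *)

(** [r] is on the left ([sg = 1]) or on the right ([sg = -1]) of the piece of
    curve of half-width [d] about [t] if some point of the piece sees [r] within
    45 degrees of its normal. The condition is open in [r], monotone in the
    piece, and refers to the velocity at the seeing point only: the sides of a
    piece and of its sub-pieces are therefore comparable without any change of
    frame. *)
Definition side (R : realType) (g : R -> R * R) (sg t d : R) (r : R * R) : Prop :=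
  exists2 s, `|s - t| < d &
    `|dot (velocity g s) (r - g s)| < sg * det2 (velocity g s) (r - g s).

Definition on_strand (R : realType) (g : R -> R * R) (t d : R) (r : R * R) : Prop :=
  exists2 s, `|s - t| < d & g s = r.

Lemma linear_form_near (R : realType) (p q c : R) (r : R * R) :
  c < p * r.1 + q * r.2 -> \forall x \near r, c < p * x.1 + q * x.2.
Proof.
have cont : {for r, continuous (fun r : R * R => p * r.1 + q * r.2)}.
  apply: (@cvgD _ _ _ (nbhs r) _ (fun r : R * R => p * r.1) (fun r => q * r.2)).
    exact: (cvgM (cvg_cst _) cvg_fst).
  exact: (cvgM (cvg_cst _) cvg_snd).
by move=> h; have H := cont _ (lt_nbhsr h); apply: H.
Qed.

Section Sides.
Context {R : realType} (g : R -> R * R) (gI : circle_immersion g).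
Implicit Types (s t d k : R) (r : R * R).

Lemma side_sub sg t d t' d' r : `|t' - t| + d' <= d ->
  side g sg t' d' r -> side g sg t d r.
Proof.
move=> dd [s sd hs]; exists s => //.
by rewrite (_ : s - t = (s - t') + (t' - t)) ?(le_lt_trans (ler_normD _ _))//; lra.
Qed.

Lemma on_strand_sub t d t' d' r : `|t' - t| + d' <= d ->
  on_strand g t' d' r -> on_strand g t d r.
Proof.
move=> dd [s sd hs]; exists s => //.
by rewrite (_ : s - t = (s - t') + (t' - t)) ?(le_lt_trans (ler_normD _ _))//; lra.
Qed.

Lemma side_open sg t d r : side g sg t d r ->
  \forall q \near r, side g sg t d q.
Proof.
move=> [s sd]; set w := velocity g s; rewrite ltr_norml => /andP[h1 h2].
have near_gt0 p q : 0 < p * (r - g s).1 + q * (r - g s).2 ->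
    \forall x \near r, 0 < p * (x - g s).1 + q * (x - g s).2.
  move=> h.
  have h' : p * (g s).1 + q * (g s).2 < p * r.1 + q * r.2 by move: h => /=; lra.
  by apply: filterS (linear_form_near h') => x /=; lra.
rewrite /dot /det2 in h1 h2.
have g1 : 0 < (w.1 - sg * w.2) * (r - g s).1 + (w.2 + sg * w.1) * (r - g s).2 by lra.
have g2 : 0 < (- w.1 - sg * w.2) * (r - g s).1 + (- w.2 + sg * w.1) * (r - g s).2.
  by lra.
have h3 := near_gt0 _ _ g1; have h4 := near_gt0 _ _ g2.
near=> x; exists s => //; rewrite -/w.
have : 0 < (w.1 - sg * w.2) * (x - g s).1 + (w.2 + sg * w.1) * (x - g s).2.
  by near: x; exact: h3.
have : 0 < (- w.1 - sg * w.2) * (x - g s).1 + (- w.2 + sg * w.1) * (x - g s).2.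
  by near: x; exact: h4.
by rewrite ltr_norml /dot /det2 => ? ?; apply/andP; split; lra.
Unshelve. all: by end_near. Qed.

Lemma dot_decomp (v w d : R * R) :
  dot v v * dot w d = dot v w * dot v d + det2 v w * det2 v d.
Proof. rewrite /dot /det2; ring. Qed.

Lemma det2_decomp (v w d : R * R) :
  dot v v * det2 w d = dot v w * det2 v d - det2 v w * dot v d.
Proof. rewrite /dot /det2; ring. Qed.

(** Project [r] onto the strand along the normal at [t], by the intermediate
    value theorem. The foot point sees [r] along that normal, so within 45
    degrees of its own one, unless it is [r]. *)
Lemma strand_cover t d : 0 < d -> \forall r \near g t,
  side g 1 t d r \/ side g (-1) t d r \/ on_strand g t d r.
Proof.
move=> d0; set v := velocity g t.
have v0 : 0 < dot v v := dot_velocity_gt0 gI t.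
have [|d1 d10 st] := straight_exists gI t (k := 4^-1); first lra.
pose e := Num.min d d1 / 2.
have e0 : 0 < e by rewrite divr_gt0// lt_min d0.
have ed : e < d.
  by rewrite /e; have : Num.min d d1 <= d; [rewrite ge_min lexx|lra].
have ed1 : e < d1.
  by rewrite /e; have : Num.min d d1 <= d1; [rewrite ge_min lexx orbT|lra].
pose h s := v.1 * (g s).1 + v.2 * (g s).2.
have hlt s s' : t - d1 < s -> s < s' -> s' < t + d1 -> h s < h s'.
  move=> s1 ss s1'; have [c /andP[? ?]] := linear_form_MVT gI v.1 v.2 ss.
  have [|+ _] := st c; first by rewrite ltr_norml; apply/andP; split; lra.
  rewrite -/v /dot => /mulr_gt0 hc hE.
  have /hc : 0 < s' - s by lra.
  by rewrite -hE /h /=; lra.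
have h1 : h (t - e) < h t by apply: hlt; lra.
have h2 : h t < h (t + e) by apply: hlt; lra.
have n1 := linear_form_near h1.
have h2' : - h (t + e) < - v.1 * (g t).1 + - v.2 * (g t).2.
  by move: h2; rewrite /h; lra.
have n2 := linear_form_near h2'.
near=> r.
have r1 : h (t - e) < v.1 * r.1 + v.2 * r.2 by near: r; exact: n1.
have r2 : v.1 * r.1 + v.2 * r.2 < h (t + e).
  have : - h (t + e) < - v.1 * r.1 + - v.2 * r.2 by near: r; exact: n2.
  lra.
have [|||s] := @IVT _ h (t - e) (t + e) (v.1 * r.1 + v.2 * r.2).
- lra.
- apply: derivable_within_continuous => x _.
  by case: (linear_form_is_derive gI v.1 v.2 x).
- by rewrite ge_min le_max (ltW r1) (ltW r2) orbT.
rewrite in_itv /= => /andP[s1 s2] hs.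
have se : `|s - t| < d by rewrite ltr_norml; apply/andP; split; lra.
have [|sv sb] := st s; first by rewrite ltr_norml; apply/andP; split; lra.
rewrite -/v in sv sb.
set w := velocity g s in sv sb.
pose x := r - g s; pose b := det2 v x.
have ax : dot v x = 0 by rewrite dotB; apply/eqP; rewrite subr_eq0; apply/eqP.
have [b0|b0] := eqVneq b 0.
  right; right; exists s => //; apply/eqP; rewrite eq_sym -subr_eq0 -/x.
  have q1 : dot v v * x.1 = v.1 * dot v x - v.2 * b by rewrite /b /dot /det2; ring.
  have q2 : dot v v * x.2 = v.2 * dot v x + v.1 * b by rewrite /b /dot /det2; ring.
  rewrite ax b0 !mulr0 subr0 in q1; rewrite ax b0 !mulr0 addr0 in q2.
  move/eqP: q1; move/eqP: q2; rewrite !mulf_eq0 !(gt_eqF v0) !orFb => /eqP q2 /eqP q1.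
  by rewrite (surjective_pairing x) q1 q2.
have main sg : sg = 1 \/ sg = -1 -> 0 < sg * b -> side g sg t d r.
  move=> sgE sb0; exists s => //; rewrite -/w -/x.
  rewrite -(ltr_pM2l v0) -[X in X * `|_|](gtr0_norm v0) -normrM dot_decomp ax.
  rewrite mulr0 add0r mulrCA det2_decomp ax mulr0 subr0 -/b normrM.
  have -> : `|b| = sg * b.
    by case: sgE sb0 => ->; rewrite ?mul1r ?mulN1r ?oppr_gt0 => ?;
      [rewrite gtr0_norm|rewrite ltr0_norm].
  rewrite [X in _ < X]mulrCA ltr_pM2r //; lra.
move: b0; rewrite neq_lt => /orP[b0|b0]; [right; left|left];
  apply: main; lra || by [left|right].
Unshelve. all: by end_near. Qed.

(** A quarter of the plane is enough: tilting a cone of slope 1 by at most 1/10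
    leaves a slope of at least (1 - 1/10) / (1 + 1/10) = 9/11 > 4/5. *)
Lemma cone_tilt_quadrant (al be a b : R) : 0 < al -> `|be| <= 10^-1 * al ->
  0 <= a -> al * (a - b) + be * (a + b) < 0 -> 4 / 5 * a < b.
Proof.
move=> al0; rewrite ler_norml => /andP[be1 be2] a0 h; rewrite ltNge; apply/negP => ba.
have [ab|ab] := lerP 0 (a + b).
  have m1 : 0 <= (10^-1 * al + be) * (a + b) by apply: mulr_ge0 => //; lra.
  have m2 : 0 <= al * (9 / 10 * a - 11 / 10 * b) by apply: mulr_ge0; lra.
  lra.
have m1 : 0 <= (10^-1 * al - be) * - (a + b) by apply: mulr_ge0; lra.
have m2 : 0 <= al * (11 / 10 * a - 9 / 10 * b) by apply: mulr_ge0; lra.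
lra.
Qed.

Lemma cone_tilt (v w x : R * R) sg : sg = 1 \/ sg = -1 ->
  0 < dot v v -> 0 < dot v w -> `|det2 v w| <= 10^-1 * dot v w ->
  `|dot w x| < sg * det2 w x -> 4 / 5 * `|dot v x| < sg * det2 v x.
Proof.
move=> sgE v0 vw vw'.
rewrite -(ltr_pM2l v0) -[X in X * `|_|](gtr0_norm v0) -normrM dot_decomp.
rewrite mulrCA det2_decomp.
move: vw vw'; set al := dot v w; set be := det2 v w.
set a := dot v x; set b := det2 v x.
rewrite ltr_norml => al0 be0 /andP[h1 h2].
have be0' : `|- be| <= 10^-1 * al by rewrite normrN.
have [a0|a0] := ger0P a; case: sgE h1 h2 => -> h1 h2.
- by apply: cone_tilt_quadrant be0 _ _ => //; lra.
- by apply: cone_tilt_quadrant be0' _ _ => //; lra.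
- by apply: cone_tilt_quadrant be0' _ _ => //; lra.
- by apply: cone_tilt_quadrant be0 _ _ => //; lra.
Qed.

(** If [r] is above [g s0] by slope at least [k] and below [g s] by slope 4/5, the
    chord from [g s0] to [g s] is steeper than [k], against the Lipschitz
    bound. *)
Lemma side_separated t k d sg s0 r : sg = 1 \/ sg = -1 ->
  0 < k -> k <= 10^-1 -> straight g t k d -> `|s0 - t| < d ->
  k * `|dot (velocity g t) (r - g s0)| <= sg * det2 (velocity g t) (r - g s0) ->
  ~ side g (- sg) t d r.
Proof.
move=> sgE k0 k1 st s0d h0 [s sd hs].
have v0 := dot_velocity_gt0 gI t.
have [vw vw'] := st s sd.
have sgE' : - sg = 1 \/ - sg = -1 by case: sgE => ->; [right|left; rewrite opprK].
have := cone_tilt sgE' v0 vw _ hs.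
have kvw : k * dot (velocity g t) (velocity g s) <=
  10^-1 * dot (velocity g t) (velocity g s) by rewrite ler_pM2r.
move=> /(_ (le_trans vw' kvw)).
have := straight_lipschitz gI st s0d sd.
move: h0; set v := velocity g t.
have -> : dot v (r - g s) = dot v (r - g s0) - dot v (g s - g s0).
  by rewrite !dotB; ring.
have -> : det2 v (r - g s) = det2 v (r - g s0) - det2 v (g s - g s0).
  by rewrite !det2B; ring.
set a := dot v _; set b := det2 v _; set a' := dot v _; set b' := det2 v _.
rewrite ler_norml => h0 /andP[h1 h2] h3.
have h4 : k * `|a - a'| < - sg * (b - b').
  by apply: le_lt_trans h3; rewrite ler_wpM2r//; lra.
have h5 : k * `|a'| <= k * `|a| + k * `|a - a'|.
  rewrite -mulrDr ler_pM2l//; have := ler_normB a (a - a').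
  by rewrite opprB addrC subrK.
case: sgE h0 h4 => -> h0 h4; lra.
Qed.

(** On a straight piece, left, right and on the strand exclude each other; with
    the covering lemma this makes the sides of a strand a partition of a
    neighbourhood. *)
Lemma side_exclusive t d : straight g t 10^-1 d -> forall sg r,
  sg = 1 \/ sg = -1 -> side g sg t d r ->
  ~ side g (- sg) t d r /\ ~ on_strand g t d r.
Proof.
move=> st sg r sgE hs; have [s sd h] := hs.
have v0 := dot_velocity_gt0 gI t.
have [vw vw'] := st s sd.
split.
  apply: (@side_separated t 10^-1 d sg s r) => //.
  have := cone_tilt sgE v0 vw vw' h.
  by have := normr_ge0 (dot (velocity g t) (r - g s)); lra.
move=> [s0 s0d gs0]; apply: (@side_separated t 10^-1 d (- sg) s0 r) => //.
- by case: sgE => ->; [right|left; rewrite opprK].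
- by rewrite gs0 det2B dotB !subrr normr0 !mulr0.
- by rewrite opprK.
Qed.

(** A cone of any small positive slope about the tangent line contains the strand
    near its apex, so that leaving this cone determines the side. The slope
    must be arbitrary because another strand may cross at a small angle. *)
Lemma side_cone t k d sg : sg = 1 \/ sg = -1 -> 0 < d -> 0 < k -> k <= 10^-1 ->
  \forall r \near g t,
    k * `|dot (velocity g t) (r - g t)| < sg * det2 (velocity g t) (r - g t) ->
    side g sg t d r.
Proof.
move=> sgE d0 k0 k1.
have [e e0 st] := straight_exists gI t k0.
pose d' := Num.min d e.
have d'0 : 0 < d' by rewrite lt_min d0.
have d'd : d' <= d by rewrite ge_min lexx.
have {}st : straight g t k d' by apply: straight_sub st; rewrite ge_min lexx orbT.
apply: filterS (strand_cover t d'0) => r cov hr.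
have t0 : `|t - t| < d' by rewrite subrr normr0.
have sep := side_separated sgE k0 k1 st t0 (ltW hr).
have noton : ~ on_strand g t d' r.
  move=> [s sd gs]; have := straight_lipschitz gI st t0 sd; rewrite gs.
  by case: sgE hr => ->; rewrite ler_norml => ? /andP[? ?]; lra.
apply: (side_sub (t' := t) (d' := d')); first by rewrite subrr normr0 add0r.
by case: cov => [|[|//]]; case: sgE sep => ->; rewrite ?opprK.
Qed.

End Sides.

(** * Periodicity *)

Section SamePoint.
Context {R : realType} {n : nat}.
Implicit Types x y z : 'I_n * R.

Lemma same_point_refl x : same_point x x.
Proof. by split=> //; exists 0; rewrite addr0. Qed.

Lemma same_point_sym x y : same_point x y -> same_point y x.
Proof.
by move=> [e [z h]]; split=> //; exists (- z); rewrite h mulrNz addrK.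
Qed.

Lemma same_point_trans x y z : same_point x y -> same_point y z -> same_point x z.
Proof.
move=> [e [m h]] [e' [k h']]; split; first by rewrite e.
by exists (m + k); rewrite h' h intrD addrA.
Qed.

(** The distance from the parameter difference to the integers is positive, and
    half of it is a suitable radius. *)
Lemma same_point_separated x y : ~ same_point x y -> exists2 rho : R, 0 < rho &
  forall s t, `|s - x.2| < rho -> `|t - y.2| < rho ->
    ~ same_point (x.1, s) (y.1, t).
Proof.
move=> nxy; have [xy|xy] := pselect (x.1 = y.1); last by exists 1 => // s t _ _ [].
set f := Num.floor (y.2 - x.2); pose a := y.2 - x.2 - f%:~R.
have f0 : f%:~R <= y.2 - x.2 := floor_le_tmp _.
have f1 : y.2 - x.2 < (f + 1)%:~R := floorD1_gt _.
rewrite intrD in f1.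
have a0 : 0 < a.
  rewrite lt_neqAle subr_ge0 f0 andbT; apply/eqP => a0; apply: nxy; split=> //.
  by exists f; move: a0; rewrite /a; lra.
pose m := Num.min a (1 - a).
have ma : m <= a by rewrite ge_min lexx.
have ma' : m <= 1 - a by rewrite ge_min lexx orbT.
have m0 : 0 < m by rewrite lt_min a0 /a; lra.
exists (m / 2); first lra.
move=> s t; rewrite !ltr_norml => /andP[? ?] /andP[? ?] [_ [z /= tE]].
have h1 : (f%:~R : R) < z%:~R by rewrite /a in ma; lra.
have h2 : (z%:~R : R) < (f + 1)%:~R by rewrite intrD; rewrite /a in ma'; lra.
by move: h1 h2; rewrite !ltr_int; lia.
Qed.

End SamePoint.

Section Periodic.
Context {R : realType} (g : R -> R * R) (gI : circle_immersion g).

Lemma periodic_int (z : int) t : g (t + z%:~R) = g t.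
Proof.
have pn (n : nat) u : g (u + n%:R) = g u.
  elim: n u => [|n IH] u; first by rewrite addr0.
  by rewrite mulrS addrA addrAC (imm_periodic gI).
case: z => n; first exact: pn.
by rewrite NegzE mulrNz; have := pn n.+1 (t - n.+1%:R); rewrite subrK => <-.
Qed.

Lemma velocity_periodic (z : int) t : velocity g (t + z%:~R) = velocity g t.
Proof.
have p1 (f : R * R -> R) : derive1 (f \o g) (t + z%:~R) = derive1 (f \o g) t.
  have E : (fun h => h^-1 *: ((f \o g) (h + (t + z%:~R)) - (f \o g) (t + z%:~R))) =
      (fun h => h^-1 *: ((f \o g) (h + t) - (f \o g) t)).
    by apply/funext => h /=; rewrite addrA !periodic_int.
  by rewrite /derive1 E.
by rewrite /velocity !p1.
Qed.

Lemma side_periodic (z : int) sg t d r : side g sg t d r -> side g sg (t + z%:~R) d r.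
Proof.
move=> [s sd h]; exists (s + z%:~R); last by rewrite velocity_periodic periodic_int.
by rewrite (_ : _ - _ = s - t)//; ring.
Qed.

Lemma on_strand_periodic (z : int) t d r : on_strand g t d r ->
  on_strand g (t + z%:~R) d r.
Proof.
move=> [s sd h]; exists (s + z%:~R); last by rewrite periodic_int.
by rewrite (_ : _ - _ = s - t)//; ring.
Qed.

End Periodic.

(** * Strands of a diagram *)

Section Diagram.
Context {R : realType} (D : vlink_diagram R).
Local Notation point := (source_point D).
Implicit Types (x y : point) (p q r : R * R) (k : 'I_(ncross D)).

Definition position x : R * R := curve x.1 x.2.

Definition crossing k : R * R := position (strand k false).

Lemma position_same x y : same_point x y -> position x = position y.
Proof.
case: x y => i t [j s] [/= <- [z ->]].
by rewrite /position /= (periodic_int (curve_immersion i)).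
Qed.

Lemma position_strand k b : position (strand k b) = crossing k.
Proof.
case: b => //; symmetry; apply/(curve_eq (strand k false) (strand k true)).
by right; exists k, false; split; exact: same_point_refl.
Qed.

Lemma same_position x y : position x = position y -> ~ is_cut predT x -> same_point x y.
Proof.
by move=> /curve_eq[//|[k [b [kx _]]]] []; exists k, b.
Qed.

Lemma crossing_cut k x : crossing k = position x -> is_cut predT x.
Proof.
move=> /(curve_eq (strand k false))[h|[k' [b [_ h]]]]; first by exists k, false.
by exists k', (~~ b).
Qed.

Lemma crossing_inj : injective crossing.
Proof.
move=> k k' /(curve_eq (strand k false) (strand k' false))[/strand_inj[]//|].
by move=> [l [b [/strand_inj[<- _] /strand_inj[<- _]]]].
Qed.

Lemma position_crossing k x :
  position x = crossing k -> exists b, same_point (strand k b) x.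
Proof.
move=> /esym/(curve_eq (strand k false))[h|[k' [b []]]]; first by exists false.
by move=> /strand_inj[-> _] h; exists (~~ b).
Qed.

Definition strand_radius x : R :=
  xget 1 [set d | 0 < d /\ straight (curve x.1) x.2 10^-1 d].

Lemma strand_radiusP x :
  0 < strand_radius x /\ straight (curve x.1) x.2 10^-1 (strand_radius x).
Proof.
rewrite /strand_radius; case: xgetP => // nd.
have [|d d0 st] := straight_exists (curve_immersion x.1) x.2 (k := 10^-1).
  by rewrite invr_gt0.
by have := nd d (conj d0 st).
Qed.

(** The half-width [strand_radius x] is one for which left and right exclude each
    other. The choice does not influence the germ at the point, by
    [left_of_compat]. *)
Definition left_of x r : bool := `[< side (curve x.1) 1 x.2 (strand_radius x) r >].

Definition near_strand x (d : R) r := on_strand (curve x.1) x.2 d r.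

Lemma left_of_on x r : near_strand x (strand_radius x) r -> left_of x r = false.
Proof.
move=> h; apply/asboolP => hs.
have [_ st] := strand_radiusP x.
by have [] := side_exclusive (curve_immersion x.1) st (or_introl erefl) hs.
Qed.

Lemma left_of_right x r :
  side (curve x.1) (-1) x.2 (strand_radius x) r -> left_of x r = false.
Proof.
move=> h; apply/asboolP => hs.
have [_ st] := strand_radiusP x.
by have [] := side_exclusive (curve_immersion x.1) st (or_introl erefl) hs.
Qed.

(** Both sides of a strand are open, so that [left_of x] can only change on the
    strand. *)
Lemma left_of_dichotomy x : \forall q \near position x,
  near_strand x (strand_radius x) q \/
  (~ near_strand x (strand_radius x) q /\ \forall r \near q, left_of x r = left_of x q).
Proof.
have [d0 st] := strand_radiusP x.
apply: filterS (strand_cover (curve_immersion x.1) x.2 d0) => q.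
have excl := side_exclusive (curve_immersion x.1) st.
move=> [h|[h|h]]; [right|right|by left].
  have [_ ?] := excl _ _ (or_introl erefl) h.
  split=> //; apply: filterS (side_open h) => r hr.
  by rewrite /left_of (asboolT h) (asboolT hr).
have [_ ?] := excl _ _ (or_intror erefl) h.
split=> //; apply: filterS (side_open h) => r hr.
by rewrite !left_of_right.
Qed.

(** Near the centre of the piece, the points of the piece have parameters near the
    central one: a point of the smaller piece's sides is on a side of the larger
    piece too, hence not on the latter. *)
Lemma near_strand_shrink x (d : R) : 0 < d -> \forall q \near position x,
  near_strand x (strand_radius x) q -> near_strand x d q.
Proof.
move=> d0; have [r0 st] := strand_radiusP x.
pose e := Num.min d (strand_radius x).
have e0 : 0 < e by rewrite lt_min d0.
apply: filterS (strand_cover (curve_immersion x.1) x.2 e0) => q.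
have excl := side_exclusive (curve_immersion x.1) st.
have er : `|x.2 - x.2| + e <= strand_radius x.
  by rewrite subrr normr0 add0r ge_min lexx orbT.
have ed : `|x.2 - x.2| + e <= d by rewrite subrr normr0 add0r ge_min lexx.
move=> [h|[h|h]] hq.
- by have [] := excl _ _ (or_introl erefl) (side_sub er h).
- by have [] := excl _ _ (or_intror erefl) (side_sub er h).
- exact: on_strand_sub ed h.
Qed.

(** Sides are monotone in the piece: near the position of [y], a small piece about
    [y] covers, and the side it assigns is also assigned by the two larger
    pieces that contain it. *)
Lemma left_of_compat x y (t : R) : `|t - x.2| < strand_radius x ->
  same_point (x.1, t) y -> \forall r \near position y, left_of x r = left_of y r.
Proof.
case: y => i s tx [/= <- {i} [z zE]].
pose e := Num.min (strand_radius (x.1, s)) (strand_radius x - `|t - x.2|).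
have e0 : 0 < e by rewrite lt_min (strand_radiusP _).1 subr_gt0.
have ey : `|s - s| + e <= strand_radius (x.1, s).
  by rewrite subrr normr0 add0r ge_min lexx.
have ex : `|t - x.2| + e <= strand_radius x.
  have : e <= strand_radius x - `|t - x.2| by rewrite ge_min lexx orbT.
  lra.
have gI := curve_immersion x.1.
have per sg r : side (curve x.1) sg s e r -> side (curve x.1) sg t e r.
  by move=> /(side_periodic gI (- z)); rewrite zE mulrNz addrK.
apply: filterS (strand_cover gI s e0) => r [h|[h|h]].
- rewrite /left_of (asboolT (side_sub ex (per _ _ h))).
  by rewrite (asboolT (side_sub (t := s) ey h)).
- rewrite !left_of_right //; first exact: (side_sub (t := s) ey h).
  exact: side_sub ex (per _ _ h).
- rewrite !left_of_on //; first exact: (on_strand_sub (t := s) ey h).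
  move: h => /(on_strand_periodic gI (- z)); rewrite zE mulrNz addrK.
  exact: on_strand_sub ex.
Qed.

(** Compactness of the circles: near [p] a diagram consists only of the strands
    that pass through [p]. *)
Lemma near_position p (d : R) : 0 < d -> \forall q \near p, forall y, position y = q ->
  exists x t, [/\ position x = p, `|t - x.2| < d & same_point (x.1, t) y].
Proof.
move=> d0.
have cov (i : 'I_(ncomp D)) : \forall q \near p, forall t, t \in `[0, 1] -> 
    curve i t = q -> exists2 t0, curve i t0 = p & `|t - t0| < d.
  have /compact_near_coveringP cpt := @segment_compact R 0 1.
  have := cpt _ (nbhs p) (fun q t => curve i t = q ->
    exists2 t0, curve i t0 = p & `|t - t0| < d).
  move=> h; apply: filterS (h _ _) => [q hq t /hq|t _] //.
  have [tp|tp] := eqVneq (curve i t) p.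
    exists (ball t d, setT) => /=; first by split; [exact: nbhsx_ballx|exact: filterT].
    by move=> [t' q] /= [tt' _] _; exists t => //; rewrite distrC.
  have := @norm_hausdorff R (R * R)%type.
  rewrite open_hausdorff => /(_ _ _ tp) [[A B] /= [+ +] [oA oB AB]].
  rewrite !inE => At Bp.
  have nA : nbhs t (curve i @^-1` A).
    by apply: (immersion_cont (curve_immersion i)); exact: open_nbhs_nbhs.
  exists (curve i @^-1` A, B) => /=; first by split=> //; exact: open_nbhs_nbhs.
  move=> [t' q] /= [At' Bq] E; exfalso.
  have : (A `&` B) q by split=> //; rewrite -E.
  by rewrite (eqP AB).
have /filter_forall {}cov := cov.
apply: filterS cov => q hq [i s] E.
pose s' := s - (Num.floor s)%:~R.
have s'01 : s' \in `[0, 1].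
  rewrite in_itv /= /s'; have := floor_le_tmp s; have := floorD1_gt s.
  by rewrite intrD => ? ?; apply/andP; split; lra.
have [|t0 t0p st0] := hq i s' s'01.
  by rewrite /s' -mulrNz (periodic_int (curve_immersion i)).
exists (i, t0), s'; split=> //; split=> //=; exists (Num.floor s).
by rewrite subrK.
Qed.

End Diagram.

(** * The local changes of the numbering *)

Section Jump.
Context {R : realType} (D : vlink_diagram R).
Local Notation point := (source_point D).
Implicit Types (x y : point) (p q r : R * R) (k : 'I_(ncross D)).

Variant strands_spec p : seq point -> Prop :=
| NoStrand of (forall x, position x <> p) : strands_spec p [::]
| OneStrand x of position x = p & ~ is_cut predT x : strands_spec p [:: x]
| TwoStrands k of crossing k = p :
    strands_spec p [:: strand k false; strand k true].

Lemma strands_exist p : exists S, strands_spec p S.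
Proof.
have [[k kp]|nk] := pselect (exists k, crossing k = p).
  by exists [:: strand k false; strand k true]; exact: TwoStrands.
have [[x xp]|nx] := pselect (exists x, position x = p).
  exists [:: x]; apply: OneStrand => // -[k [b [_ kx]]]; apply: nk; exists k.
  by rewrite -(position_strand k b) (position_same kx).
by exists [::]; apply: NoStrand => x xp; apply: nx; exists x.
Qed.

Definition strands p : seq point := projT1 (cid (strands_exist p)).

Lemma strandsP p : strands_spec p (strands p).
Proof. exact: projT2 (cid (strands_exist p)). Qed.

(** The prescribed change of the Alexander numbering: crossing a strand from its
    right to its left adds one. Points on a strand are counted as being on its
    right. *)
Definition jump p r : int := \sum_(x <- strands p) (left_of x r : nat)%:Z.

Lemma jump_off p r : (forall x, position x <> p) -> jump p r = 0.
Proof.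
rewrite /jump; case: strandsP => [_|x xp _|k kp] nx; first by rewrite big_nil.
  by case: (nx x).
by case: (nx (strand k false)).
Qed.

Lemma jump_uncut x : ~ is_cut predT x ->
  \forall r \near position x, jump (position x) r = (left_of x r : nat)%:Z.
Proof.
move=> xc; rewrite /jump; case: strandsP => [/(_ x)//|y yx yc|k kp].

  have xx : `|x.2 - x.2| < strand_radius x.
    by rewrite subrr normr0 (strand_radiusP x).1.
  have xy : same_point (x.1, x.2) y.
    rewrite -surjective_pairing; apply: same_point_sym.
    exact: same_position yx yc.
  by rewrite -yx; apply: filterS (left_of_compat xx xy) => r ->; rewrite big_seq1.
by case: xc; exact: crossing_cut kp.
Qed.

Lemma jump_crossing k r : jump (crossing k) r =
  (left_of (strand k false) r : nat)%:Z + (left_of (strand k true) r : nat)%:Z.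
Proof.
rewrite /jump; case: strandsP => [/(_ (strand k false))//|x xk xc|k' /crossing_inj ->].
  by case: xc; apply: crossing_cut (esym xk).
by rewrite big_cons big_seq1.
Qed.

Lemma near_uncrossed p : \forall q \near p, q <> p -> forall x, position x = q ->
  ~ is_cut predT x.
Proof.
have h k : \forall q \near p, q <> p -> crossing k <> q.
  have [->|kp] := eqVneq (crossing k) p; first by apply: filterE => q qp /esym.
  have : nbhs p (~` [set crossing k]).
    apply: open_nbhs_nbhs; split; last by move=> /= /esym /eqP; apply/negP.
    apply: closed_openC; apply: compact_closed; last exact: compact_set1.
    exact: (@norm_hausdorff R (R * R)%type).
  by apply: filterS => q /= qk _ /esym.
have /filter_forall hall := h.
apply: filterS hall => q hq qp x xq [k [b [_ kx]]].
by apply: (hq k qp); rewrite -(position_strand k b) (position_same kx).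
Qed.

Lemma left_of_position x : left_of x (position x) = false.
Proof.
by rewrite left_of_on//; exists x.2 => //; rewrite subrr normr0 (strand_radiusP x).1.
Qed.

Lemma near_strand_uncut x q : (forall y, position y = q -> ~ is_cut predT y) ->
  near_strand x (strand_radius x) q ->
  \forall r \near q, jump q r = (left_of x r : nat)%:Z.
Proof.
move=> qc [t tx tq].
pose y : point := (x.1, t).
have yq : position y = q by [].
have := left_of_compat tx (same_point_refl y); have := jump_uncut (qc y yq).
by rewrite yq; apply: filterS2 => r -> ->.
Qed.

Lemma near_strand_same x x' y (t d : R) : same_point x x' ->
  `|t - x'.2| < d -> same_point (x'.1, t) y -> near_strand x d (position y).
Proof.
case: x x' => [i s] [i' s'] /= [/= <- [z ->]] ts ty.
have : near_strand (i, s + z%:~R) d (position y).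
  by exists t => //; rewrite -(position_same ty).
move=> /(on_strand_periodic (curve_immersion i) (- z)).
by rewrite /near_strand /= mulrNz addrK.
Qed.

(** Near [p], the strands through [q] are continuations of strands through [p], and
    at most one of them unless [q] is [p], since crossings are isolated. Strands
    of [p] that continue through [q] have the same sides there; the other
    strands of [p] have a constant side near [q] and contribute a constant. *)
Lemma jump_germ_cocycle : germ_cocycle jump.
Proof.
move=> p; case Sp: _ / (strandsP p) => [nx|x xp xc|k kp].
- apply: filterS (near_position D p ltr01) => q hq.
  have nq y : position y <> q by move=> /hq[x [t [/nx]]].
  by apply: filterE => r; rewrite !jump_off.
- have jp r : jump p r = (left_of x r : nat)%:Z by rewrite /jump Sp big_seq1.
  have d0 := (strand_radiusP x).1.
  have n1 := left_of_dichotomy x; rewrite xp in n1.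
  apply: filterS (filterI n1 (filterI (near_uncrossed p) (near_position D p d0))).
  move=> q [D1 [U N]].
  have qc y : position y = q -> ~ is_cut predT y.
    have [->|/eqP qp] := eqVneq q p; last exact: U.
    move=> yp [k [b [_ ky]]]; apply: xc; apply: (@crossing_cut _ _ k).
    by rewrite xp -yp -(position_same ky) position_strand.
  case: D1 => [on|[noton lq]].
    apply: filterS (near_strand_uncut qc on) => r.
    by rewrite !jp => ->; rewrite (left_of_on on) add0r.
  have nq y : position y <> q.
    move=> yq; have [x' [t [x'p tx ty]]] := N y yq.
    have xx' : same_point x x' by apply: same_position => //; rewrite xp.
    by apply: noton; rewrite -yq; exact: near_strand_same xx' tx ty.
  by apply: filterS lq => r; rewrite !jp (jump_off _ nq) addr0 => ->.
- have jp r : jump p r = (left_of (strand k false) r : nat)%:Z +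
      (left_of (strand k true) r : nat)%:Z by rewrite -kp jump_crossing.
  pose x1 : point := strand k false; pose x2 : point := strand k true.
  have x1p : position x1 = p by rewrite position_strand.
  have x2p : position x2 = p by rewrite position_strand.
  have n12 : ~ same_point x1 x2 by move=> /strand_inj[].
  have [rho rho0 sep] := same_point_separated n12.
  have d1 := (strand_radiusP x1).1; have d2 := (strand_radiusP x2).1.
  have dich1 := left_of_dichotomy x1; rewrite x1p in dich1.
  have dich2 := left_of_dichotomy x2; rewrite x2p in dich2.
  have shr1 := near_strand_shrink x1 rho0; rewrite x1p in shr1.
  have shr2 := near_strand_shrink x2 rho0; rewrite x2p in shr2.
  pose d := Num.min (strand_radius x1) (strand_radius x2).
  have d0 : 0 < d by rewrite lt_min d1.
  have unc := near_uncrossed p; have npos := near_position D p d0.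
  apply: filterS (filterI (filterI dich1 dich2)
    (filterI (filterI shr1 shr2) (filterI unc npos))).
  move=> q [[D1 D2] [[S1 S2] [U N]]].
  have [->|/eqP qp] := eqVneq q p.
    have l1 : left_of x1 p = false by rewrite -x1p left_of_position.
    have l2 : left_of x2 p = false by rewrite -x2p left_of_position.
    by apply: filterE => r; rewrite (jp p) l1 l2 !add0r.
  have qc := U qp.
  case: D1 => [on1|[non1 l1]]; case: D2 => [on2|[non2 l2]].
  + have [t1 t1x t1q] := S1 on1; have [t2 t2x t2q] := S2 on2.
    (* two strands of p meeting again at q would make q another crossing *)
    case: (sep _ _ t1x t2x); apply: same_position; last exact: qc.
    by rewrite /position /= t1q t2q.
  + have := near_strand_uncut qc on1; apply: filterS2 l2 => r l2 ->.
    by rewrite !jp -/x1 -/x2 l2 (left_of_on on1) add0r addrC.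
  + have := near_strand_uncut qc on2; apply: filterS2 l1 => r l1 ->.
    by rewrite !jp -/x1 -/x2 l1 (left_of_on on2) addr0.
  + have nq y : position y <> q.
      move=> yq; have [x [t [xp tx ty]]] := N y yq.
      have [[|] /= xb] := @position_crossing _ _ k x (etrans xp (esym kp)).
        apply: non2; rewrite -yq; apply: near_strand_same xb _ ty.
        by apply: lt_le_trans tx _; rewrite ge_min lexx orbT.
      apply: non1; rewrite -yq; apply: near_strand_same xb _ ty.
      by apply: lt_le_trans tx _; rewrite ge_min lexx.
    by apply: filterS2 l1 l2 => r l1 l2; rewrite !jp -/x1 -/x2 l1 l2 jump_off// addr0.
Qed.

End Jump.

(** * The Alexander numbering *)

Section PlanarNumbering.
Context {R : realType} (D : vlink_diagram R).
Local Notation point := (source_point D).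
Implicit Types (x y : point) (p q r : R * R) (k : 'I_(ncross D)).

Lemma curves_bounded :
  exists2 M : R, 0 <= M & forall x, rect (- M) M (- M) M (position x).
Proof.
have bnd (i : 'I_(ncomp D)) : \forall M \near +oo, forall t, t \in `[0, 1] ->
    rect (- M) M (- M) M (curve i t).
  have /compact_near_coveringP cpt := @segment_compact R 0 1.
  have := cpt _ (+oo%R : set_system R) (fun M t => rect (- M) M (- M) M (curve i t)).
  move=> h; apply: filterS (h _ _) => [M hM t /hM|t _] //.
  pose N := `|(curve i t).1| + `|(curve i t).2| + 1.
  have near_form (a b : R) : - N < a * (curve i t).1 + b * (curve i t).2 ->
      \forall t' \near t, - N < a * (curve i t').1 + b * (curve i t').2.
    by move=> /linear_form_near h1; exact: (immersion_cont (curve_immersion i) h1).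
  have [n1 n2] := (ler_norm (curve i t).1, ler_norm (curve i t).2).
  have [n3 n4] := (ler_norm (- (curve i t).1), ler_norm (- (curve i t).2)).
  rewrite !normrN in n3 n4.
  have [p1 p2] := (normr_ge0 (curve i t).1, normr_ge0 (curve i t).2).
  have [h1 h2] : - N < 1 * (curve i t).1 + 0 * (curve i t).2 /\
    - N < (- 1) * (curve i t).1 + 0 * (curve i t).2 by rewrite /N; lra.
  have [h3 h4] : - N < 0 * (curve i t).1 + 1 * (curve i t).2 /\
    - N < 0 * (curve i t).1 + (- 1) * (curve i t).2 by rewrite /N; lra.
  have hh := filterI (filterI (near_form _ _ h1) (near_form _ _ h2))
                     (filterI (near_form _ _ h3) (near_form _ _ h4)).
  exists ([set t' | (- N < 1 * (curve i t').1 + 0 * (curve i t').2 /\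
      - N < (- 1) * (curve i t').1 + 0 * (curve i t').2) /\
     (- N < 0 * (curve i t').1 + 1 * (curve i t').2 /\
      - N < 0 * (curve i t').1 + (- 1) * (curve i t').2)], [set M | N < M]) => /=.
    split; [exact: hh|exact: (nbhs_pinfty_gt (num_real N))].
  move=> [t' M] /= [[[g1 g2] [g3 g4]] NM].
  by rewrite /rect /=; split; apply/andP; split; lra.
have /filter_forall {}bnd := bnd.
have [M [hM M0]] := filter_ex (filterI bnd (nbhs_pinfty_ge (num_real 0))).
exists M => // -[i t].
have {hM} := hM i (t - (Num.floor t)%:~R).
rewrite -mulrNz (periodic_int (curve_immersion i)); apply.
rewrite in_itv /= mulrNz; have := floor_le_tmp t; have := floorD1_gt t.
by rewrite intrD => ? ?; apply/andP; split; lra.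
Qed.

(** The winding number has this property if at the points of the image it is
    read on the right of the curve. *)
Definition curve_numbering (W : R * R -> int) := forall x,
  \forall r \near position x, (exists y, position y = r) ->
    W r = W (position x) + jump D (position x) r.

(** All curves lie in one square, and the square is simply connected. On a torus
    the statement fails. *)
Lemma curve_numbering_exists : exists W, curve_numbering W.
Proof.
have [M M0 hM] := curves_bounded.
have leM : - M <= M by lra.
have [W nW] := numbering_exists (@jump_germ_cocycle R D) leM leM.
by exists W => x; apply: filterS (nW _ (hM x)) => r hr [y yr]; apply: hr; rewrite -yr.
Qed.

Variables (W : R * R -> int) (nW : curve_numbering W).

Lemma near_along x (P : R * R -> Prop) : (\forall r \near position x, P r) ->
  \forall s \near x.2, P (position (x.1, s)).
Proof. by move=> h; exact: (immersion_cont (curve_immersion x.1) h). Qed.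

Lemma numbering_along x : \forall s \near x.2,
  W (position (x.1, s)) = W (position x) + jump D (position x) (position (x.1, s)).
Proof.
by apply: filterS (near_along (nW x)) => s; apply; exists (x.1, s).
Qed.

Lemma near_self x : \forall s \near x.2, left_of x (position (x.1, s)) = false.
Proof.
apply: filterS (nbhsx_ballx x.2 _ (strand_radiusP x).1) => s xs.
by rewrite left_of_on//; exists s => //; rewrite distrC.
Qed.

Lemma numbering_uncut x : ~ is_cut predT x ->
  \forall s \near x.2, W (position (x.1, s)) = W (position x).
Proof.
move=> xc; have h := near_along (jump_uncut xc).
apply: filterS (filterI (numbering_along x) (filterI h (near_self x))) => s.
by move=> [-> [-> ->]]; rewrite addr0.
Qed.

(** At a transversal crossing, a strand leaves on the side of the other strand
    to which its velocity points: its displacement stays outside a thin cone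
    about the other tangent line. *)
Lemma transversal_sides x y (sg : R) : position x = position y ->
  sg = 1 \/ sg = -1 ->
  0 < sg * det2 (velocity (curve y.1) y.2) (velocity (curve x.1) x.2) ->
  \forall s \near x.2,
    (x.2 < s -> side (curve y.1) sg y.2 (strand_radius y) (position (x.1, s))) /\
    (s < x.2 -> side (curve y.1) (- sg) y.2 (strand_radius y) (position (x.1, s))).
Proof.
move=> xy sgE; set u := velocity _ y.2; set v := velocity _ x.2 => uv.
have gI := curve_immersion x.1; have gI' := curve_immersion y.1.
pose m := `|dot u v| + 1.
have m0 : 0 < m by rewrite /m ltr_wpDl.
(* small enough that the velocity v is outside the cone of slope kap about u *)
pose kap : R := Num.min 10^-1 (sg * det2 u v / m).
have kap0 : 0 < kap by rewrite lt_min divr_gt0// andbT invr_gt0.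
have kap1 : kap <= 10^-1 by rewrite ge_min lexx.
have kapm : kap * m <= sg * det2 u v by rewrite -ler_pdivlMr// ge_min lexx orbT.
have hv : kap * `|dot u v| < sg * det2 u v by move: kapm; rewrite /m; lra.
have hn : `|kap * dot u v| < sg * det2 u v by rewrite normrM (gtr0_norm kap0).
have sgE' : - sg = 1 \/ - sg = -1 by case: sgE => ->; [right|left; rewrite opprK].
have d0 := (strand_radiusP y).1.
have cone z (zE : z = 1 \/ z = -1) : \forall s \near x.2,
    kap * `|dot u (position (x.1, s) - position y)| <
      z * det2 u (position (x.1, s) - position y) ->
    side (curve y.1) z y.2 (strand_radius y) (position (x.1, s)).
  have h := side_cone gI' y.2 zE d0 kap0 kap1.
  apply: (near_along (P := fun r => kap * `|dot u (r - position y)| <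
    z * det2 u (r - position y) -> side (curve y.1) z y.2 (strand_radius y) r)).
  by rewrite xy; exact: h.
move: hn; rewrite ltr_norml => /andP[hn1 hn2].
have f1 : 0 < (- sg * u.2 + kap * u.1) * v.1 + (sg * u.1 + kap * u.2) * v.2.
  by move: hn1; rewrite /dot /det2; lra.
have f2 : 0 < (- sg * u.2 - kap * u.1) * v.1 + (sg * u.1 - kap * u.2) * v.2.
  by move: hn2; rewrite /dot /det2; lra.
have s1 := linear_form_sides gI f1; have s2 := linear_form_sides gI f2.
apply: filterS (filterI (filterI s1 s2) (filterI (cone _ sgE) (cone _ sgE'))).
move=> s [[[a1 a2] [b1 b2]] [c1 c2]].
set w := position (x.1, s) - position y.
have wE : curve x.1 s - curve x.1 x.2 = w by rewrite /w -xy.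
rewrite wE in a1 a2 b1 b2.
rewrite -(gtr0_norm kap0) -normrM ltr_norml in c1.
rewrite -(gtr0_norm kap0) -normrM ltr_norml in c2.
split=> xs.
  by apply: c1; have := a1 xs; have := b1 xs; rewrite -/w /dot /det2 => ? ?;
    apply/andP; split; lra.
by apply: c2; have := a2 xs; have := b2 xs; rewrite -/w /dot /det2 => ? ?;
  apply/andP; split; lra.
Qed.

(** The strand itself is not to the left of itself, so that only the other strand
    changes the numbering: it is one more on the part that is to the left of the
    other strand. The base value is the same for both strands of the crossing,
    and this is what the classical rule needs. *)
Lemma numbering_crossing k b :
  let left_after := 0 < det2 (strand_velocity k (~~ b)) (strand_velocity k b) in
  \forall s \near (strand k b).2,
    ((strand k b).2 < s -> W (position ((strand k b).1, s)) =
       W (crossing k) + (left_after : nat)%:Z) /\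
    (s < (strand k b).2 -> W (position ((strand k b).1, s)) =
       W (crossing k) + (~~ left_after : nat)%:Z).
Proof.
move=> la; set x : point := strand k b; pose y : point := strand k (~~ b).
have xk : position x = crossing k := position_strand k b.
have xy : position x = position y by rewrite xk position_strand.
have jE r : jump D (crossing k) r = (left_of x r : nat)%:Z + (left_of y r : nat)%:Z.
  by rewrite jump_crossing /x /y; case: (b) => //=; rewrite addrC.
pose sg : R := if la then 1 else -1.
have sgE : sg = 1 \/ sg = -1 by rewrite /sg; case: ifP; [left|right].
have sgP : 0 < sg * det2 (velocity (curve y.1) y.2) (velocity (curve x.1) x.2).
  rewrite /sg /la /strand_velocity -/x -/y; case: ifPn; first by rewrite mul1r.
  rewrite mulN1r oppr_gt0 -leNgt le_eqVlt => /orP[/eqP d0|//]; exfalso.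
  have := strand_transversal k.
  by move: d0; rewrite /x /y; case: (b) => /= d0;
    [rewrite d0 eqxx|rewrite -oppr_eq0 (_ : - _ = 0) ?eqxx// -[RHS]d0 /det2; ring].
have := transversal_sides xy sgE sgP.
move=> ts; apply: filterS (filterI (numbering_along x) (filterI ts (near_self x))).
move=> s [hW [[t1 t2] lx]].
have lL r : side (curve y.1) 1 y.2 (strand_radius y) r -> left_of y r.
  by move=> ?; apply/asboolP.
rewrite hW xk jE lx add0r.
have [E|E] : la = true \/ la = false by case: (la); [left|right].
all: rewrite /sg E in t1 t2; rewrite E; split=> xs.
- by rewrite lL//; exact: t1.
- by rewrite left_of_right//; exact: t2.
- by rewrite left_of_right//; exact: t1.
- by rewrite lL//; have := t2 xs; rewrite opprK.
Qed.

End PlanarNumbering.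

(** * Arcs *)

Section ArcTheory.
Context {R : realType} (D : vlink_diagram R).
Local Notation point := (source_point D).
Implicit Types (x y z : point) (k : 'I_(ncross D)) (K : pred 'I_(ncross D)).

Lemma is_cut_same K x y : same_point x y -> is_cut K x -> is_cut K y.
Proof.
by move=> xy [k [b [Kk kx]]]; exists k, b; split=> //; exact: same_point_trans kx xy.
Qed.

Lemma is_cut_sub K K' x : (forall k, K k -> K' k) -> is_cut K x -> is_cut K' x.
Proof. by move=> sub [k [b [/sub Kk kx]]]; exists k, b. Qed.

Lemma same_arc_refl K x : ~ is_cut K x -> same_arc K x x.
Proof.
move=> xc; split=> //; exists 0 => t; rewrite addr0 minxx maxxx => /le_anti <-.
by rewrite -surjective_pairing.
Qed.

Lemma same_point_shift (i : 'I_(ncomp D)) (t : R) (m : int) :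
  same_point (i, t) (i, t + m%:~R).
Proof. by split=> //; exists m. Qed.

Lemma same_arc_sym K x y : same_arc K x y -> same_arc K y x.
Proof.
case: x y => i s [j t] [/= <- [m h]]; split=> //=; exists (- m) => u hu cut.
apply: (h (u + m%:~R)); last exact: is_cut_same (same_point_shift _ _ _) cut.
by move: hu; rewrite mulrNz !ge_min !le_max => /andP[/orP hu1 /orP hu2];
  apply/andP; split; apply/orP; case: hu1 hu2 => ? [] ?; lra.
Qed.

Lemma same_arc_trans K x y z : same_arc K x y -> same_arc K y z -> same_arc K x z.
Proof.
case: x y z => i s [j t] [j' u] [/= <- [m h1]] [/= <- [n h2]].
split=> //=; exists (n + m) => w hw.
have [hw1|hw1] := boolP (Num.min s (t + m%:~R) <= w <= Num.max s (t + m%:~R)).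
  exact: h1.
move=> cut; apply: (h2 (w - m%:~R)); last first.
  by apply: is_cut_same cut; rewrite -mulrNz; exact: same_point_shift.
move: hw hw1; rewrite intrD.
rewrite negb_and -!ltNge !ge_min !le_max lt_min gt_max => /andP[/orP a /orP b] /orP c.
apply/andP; split; apply/orP.
  by case: a b c => [? [] ? []|? [] ? []] /andP[? ?]; lra.
by case: a b c => [? [] ? []|? [] ? []] /andP[? ?]; lra.
Qed.

Section Arc.
Variable K : pred 'I_(ncross D).
Implicit Types A B : arc_type K.

Lemma arc_same A x y : sval A x -> sval A y -> same_arc K x y.
Proof.
case: A => A /= [p [_ ->]] px py.
exact: same_arc_trans (same_arc_sym px) py.
Qed.

Lemma arc_closed A x y : sval A x -> same_arc K x y -> sval A y.
Proof. case: A => A /= [p [_ ->]] px xy; exact: same_arc_trans px xy. Qed.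

Lemma arc_uncut A x : sval A x -> ~ is_cut K x.
Proof.
case: A => A /= [[i s] [_ ->]]; case: x => j t [/= <- [m h]] cut.
apply: (h (t + m%:~R)); last exact: is_cut_same (same_point_shift _ _ _) cut.
by rewrite ge_min le_max lexx !orbT.
Qed.

Lemma arc_unique A B x : sval A x -> sval B x -> A = B.
Proof.
move=> Ax Bx; have E : sval A = sval B.
  apply/seteqP; split=> y.
    by move=> Ay; exact: arc_closed Bx (arc_same Ax Ay).
  by move=> By; exact: arc_closed Ax (arc_same Bx By).
case: A B E {Ax Bx} => A hA [B hB] /= E; subst B.
by congr exist; exact: Prop_irrelevance.
Qed.

Lemma arc_through x : ~ is_cut K x -> exists A, sval A x.
Proof.
move=> xc; have Ax : arcs K [set q | same_arc K x q] by exists x.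
by exists (exist _ _ Ax); exact: same_arc_refl.
Qed.

Lemma arc_nonempty A : exists x, sval A x.
Proof. by case: A => A /= [p [pc ->]]; exists p; exact: same_arc_refl. Qed.

Lemma same_point_arc A x y : same_point x y -> sval A x -> sval A y.
Proof.
case: x y => i s [j t] [/= <- [m ->]] Ax; have xc := arc_uncut Ax.
apply: arc_closed Ax _; split=> //=; exists (- m) => u.
by rewrite mulrNz addrK minxx maxxx => /le_anti <-.
Qed.

Lemma arc_before_unique A B x : arc_before x A -> arc_before x B -> A = B.
Proof.
move=> hA hB.
have nAB : \forall s \near x.2^'-, sval A (x.1, s) /\ sval B (x.1, s) by exact: filterI.
have [s [As Bs]] := @filter_ex _ _ (at_left_proper_filter x.2) _ nAB.
exact: arc_unique As Bs.
Qed.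

Lemma arc_after_unique A B x : arc_after x A -> arc_after x B -> A = B.
Proof.
move=> hA hB.
have nAB : \forall s \near x.2^'+, sval A (x.1, s) /\ sval B (x.1, s) by exact: filterI.
have [s [As Bs]] := @filter_ex _ _ (at_right_proper_filter x.2) _ nAB.
exact: arc_unique As Bs.
Qed.


End Arc.

Lemma cuts_isolated x : exists2 e : R, 0 < e & forall s, s <> x.2 ->
  `|s - x.2| < e -> ~ is_cut predT (x.1, s).
Proof.
have gI := curve_immersion x.1.
have := linear_form_sides gI (dot_velocity_gt0 gI x.2 : 0 < _ * _ + _ * _).
have := near_along (near_uncrossed D (position x)).
move=> h1 h2; have [e e0 he] := near_dist (filterI h1 h2).
exists e => // s sx se; have [unc [h3 h4]] := he s se.
apply: (unc _ (x.1, s)) => // eq.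
have : curve x.1 s - curve x.1 x.2 = 0 by apply/eqP; rewrite subr_eq0; apply/eqP.
move=> E; rewrite E in h3 h4.
have [xs|xs|//] := ltgtP s x.2.
  by have := h4 xs; rewrite !mulr0 addr0 ltxx.
by have := h3 xs; rewrite !mulr0 addr0 ltxx.
Qed.

Lemma uncut_segment_arc K (i : 'I_(ncomp D)) (a b : R) : a < b ->
  (forall t, a < t < b -> ~ is_cut K (i, t)) ->
  exists A : arc_type K, forall t, a < t < b -> sval A (i, t).
Proof.
move=> ab h; pose m := (a + b) / 2.
have [|A Am] := @arc_through K (i, m).
  by apply: h; apply/andP; split; rewrite /m; lra.
exists A => t /andP[ta tb]; apply: arc_closed Am _; split=> //=; exists 0 => u.
rewrite addr0 ge_min le_max /m => /andP[/orP u1 /orP u2]; apply: h.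
by apply/andP; split; [case: u1|case: u2] => ?; lra.
Qed.

Lemma arc_after_exists K x : exists A : arc_type K, arc_after x A.
Proof.
have [e e0 he] := cuts_isolated x.
have [||A hA] := @uncut_segment_arc K x.1 x.2 (x.2 + e); first lra.
  move=> t /andP[t1 t2] cut; apply: (he t); last exact: is_cut_sub cut.
    by move=> tx; rewrite tx ltxx in t1.
  by rewrite ltr_norml; apply/andP; split; lra.
exists A; rewrite /arc_after; near=> t; apply: hA; apply/andP; split.
  by near: t; exact: nbhs_right_gt.
by near: t; apply: nbhs_right_lt; lra.
Unshelve. all: by end_near. Qed.

Lemma arc_before_exists K x : exists A : arc_type K, arc_before x A.
Proof.
have [e e0 he] := cuts_isolated x.
have [||A hA] := @uncut_segment_arc K x.1 (x.2 - e) x.2; first lra.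
  move=> t /andP[t1 t2] cut; apply: (he t); last exact: is_cut_sub cut.
    by move=> tx; rewrite tx ltxx in t2.
  by rewrite ltr_norml; apply/andP; split; lra.
exists A; rewrite /arc_before; near=> t; apply: hA; apply/andP; split.
  by near: t; apply: nbhs_left_gt; lra.
by near: t; exact: nbhs_left_lt.
Unshelve. all: by end_near. Qed.

Lemma arc_near K (A : arc_type K) x : sval A x -> \forall s \near x.2, sval A (x.1, s).
Proof.
move=> Ax; have [e e0 he] := cuts_isolated x.
have xc := arc_uncut Ax.
have [||B hB] := @uncut_segment_arc K x.1 (x.2 - e) (x.2 + e); first lra.
  move=> t /andP[t1 t2]; have [->|/eqP tx] := eqVneq t x.2.
    by rewrite -surjective_pairing.
  move=> cut; apply: (he t) => //; last exact: is_cut_sub cut.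
  by rewrite ltr_norml; apply/andP; split; lra.
have Bx : sval B x.
  by rewrite (surjective_pairing x); apply: hB; apply/andP; split; lra.
rewrite (arc_unique Ax Bx).
apply/nbhs_ballP; exists e => // t; rewrite /ball /= ltr_norml => /andP[t1 t2].
by apply: hB; apply/andP; split; lra.
Qed.

Lemma arc_after_mem K (A : arc_type K) x : sval A x -> arc_after x A.
Proof.
move=> Ax; suff : \forall s \near x.2, x.2 < s -> sval A (x.1, s) by [].
by apply: filterS (arc_near Ax).
Qed.

Lemma arc_before_mem K (A : arc_type K) x : sval A x -> arc_before x A.
Proof.
move=> Ax; suff : \forall s \near x.2, s < x.2 -> sval A (x.1, s) by [].
by apply: filterS (arc_near Ax).
Qed.

Lemma arc_sub K (a : short_arc D) (A : arc_type K) x y :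
  sval a x -> sval A x -> sval a y -> sval A y.
Proof.
move=> ax Ax ay; have [xy [m h]] := arc_same ax ay.
apply: arc_closed Ax _; split=> //; exists m => t ht cut.
by apply: (h t ht); exact: is_cut_sub cut.
Qed.

Lemma locally_constant_segment (T : Type) (F : R -> T) (a b : R) : a <= b ->
  (forall t, a <= t <= b -> \forall s \near t, F s = F t) -> F a = F b.
Proof.
move=> ab h; apply: (interval_chain (P := fun s t => F s = F t)) => //.
  by move=> ? ? ? _ _ _ _ ->.
move=> t /h /nbhs_ballP[e /= e0 he]; exists e => // s s' _ _ _ ts ts'.
by rewrite (he s) ?(he s') // /ball /= distrC.
Qed.

(** Short arcs get their index, and long arcs their colour, from this lemma. *)
Lemma arc_constant K (T : Type) (F : point -> T) x y :
  (forall x y, same_point x y -> F x = F y) ->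
  (forall x, ~ is_cut K x -> \forall s \near x.2, F (x.1, s) = F x) ->
  same_arc K x y -> F x = F y.
Proof.
case: x y => i s [j t] Fsame Floc [/= <- [m h]].
rewrite (Fsame _ _ (same_point_shift i t m)).
have loc u : Num.min s (t + m%:~R) <= u <= Num.max s (t + m%:~R) ->
    \forall v \near u, F (i, v) = F (i, u).
  by move=> /h hu; exact: (Floc (i, u)).
have [st|st] := leP s (t + m%:~R).
  apply: (locally_constant_segment (F := fun u => F (i, u))) => // u hu.
  by apply: loc; rewrite (min_l st) (max_r st).
symmetry; apply: (locally_constant_segment (F := fun u => F (i, u))); first exact: ltW.
by move=> u hu; apply: loc; rewrite (min_r (ltW st)) (max_l (ltW st)).
Qed.

Lemma arc_after_same K (A : arc_type K) x y : same_point x y ->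
  arc_after x A -> arc_after y A.
Proof.
case: x y => i s [j t] [/= <- [m ->]] xA.
have [e e0 he] : exists2 e : R, 0 < e &
    forall u, `|u - s| < e -> s < u -> sval A (i, u).
  by apply: near_dist; exact: xA.
suff : \forall u \near s + m%:~R, s + m%:~R < u -> sval A (i, u) by [].
apply/nbhs_ballP; exists e => // u; rewrite /ball /= ltr_norml => /andP[? ?] ?.
have /(same_point_arc (same_point_shift i (u - m%:~R) m)) : sval A (i, u - m%:~R).
  by apply: he; [rewrite ltr_norml; apply/andP; split|]; lra.
by rewrite subrK.
Qed.

Lemma arc_before_same K (A : arc_type K) x y : same_point x y ->
  arc_before x A -> arc_before y A.
Proof.
case: x y => i s [j t] [/= <- [m ->]] xA.
have [e e0 he] : exists2 e : R, 0 < e &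
    forall u, `|u - s| < e -> u < s -> sval A (i, u).
  by apply: near_dist; exact: xA.
suff : \forall u \near s + m%:~R, u < s + m%:~R -> sval A (i, u) by [].
apply/nbhs_ballP; exists e => // u; rewrite /ball /= ltr_norml => /andP[? ?] ?.
have /(same_point_arc (same_point_shift i (u - m%:~R) m)) : sval A (i, u - m%:~R).
  by apply: he; [rewrite ltr_norml; apply/andP; split|]; lra.
by rewrite subrK.
Qed.

End ArcTheory.

(** * Twisted biquandles *)

Section IntegerPower.
Variables (B : Type).
Implicit Types (f finv : B -> B) (z : int).

(** The inverse is a separate argument, so that exchanging [f] and [finv] gives
    the inverse of a power without a change of sign in [z]. *)
Definition fpow f finv z (x : B) : B :=
  match z with Posz n => iter n f x | Negz n => iter n.+1 finv x end.

Lemma fpowS f finv z x : cancel finv f -> fpow f finv (z + 1) x = f (fpow f finv z x).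
Proof.
move=> finvK; case: z => n; first by rewrite (_ : Posz n + 1 = n.+1)//; lia.
case: n => [|n]; first by rewrite (_ : Negz 0 + 1 = 0) /= ?finvK//; lia.
by rewrite (_ : Negz n.+1 + 1 = Negz n); [rewrite /= !finvK|lia].
Qed.

Lemma fpowSr f finv z x : cancel f finv -> cancel finv f ->
  fpow f finv (z + 1) x = fpow f finv z (f x).
Proof.
move=> fK finvK; rewrite fpowS//; case: z => n; first by rewrite -iterS iterSr.
by rewrite /fpow (iterSr n finv (f x)) fK /= finvK.
Qed.

Lemma fpowK f finv z : cancel f finv -> cancel finv f ->
  cancel (fpow f finv z) (fpow finv f z).
Proof.
have iterK h h' n : cancel h h' -> cancel (iter n h) (iter n h').
  by move=> hK x; elim: n x => // n IH x; rewrite iterSr /= hK IH.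
by move=> fK finvK; case: z => n; exact: iterK.
Qed.

Lemma fpow_morph f finv (op : B -> B -> B) :
  (forall x y, f (op x y) = op (f x) (f y)) ->
  (forall x y, finv (op x y) = op (finv x) (finv y)) ->
  forall z x y, fpow f finv z (op x y) = op (fpow f finv z x) (fpow f finv z y).
Proof.
have it h n : (forall x y, h (op x y) = op (h x) (h y)) ->
    forall x y, iter n h (op x y) = op (iter n h x) (iter n h y).
  by move=> hop x y; elim: n => //= n ->; rewrite hop.
by move=> fop finvop [] n; exact: it.
Qed.

End IntegerPower.

Section Twist.
Variables (B : Type) (circ ast : B -> B -> B) (f finv : B -> B).
Hypothesis hB : is_virtual_biquandle circ ast f finv.

Let fK : cancel f finv := vbiq_fK hB.
Let finvK : cancel finv f := vbiq_finvK hB.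

Lemma finv_morph (op : B -> B -> B) :
  (forall x y, f (op x y) = op (f x) (f y)) ->
  forall x y, finv (op x y) = op (finv x) (finv y).
Proof. by move=> fop x y; rewrite -[RHS]fK fop !finvK. Qed.

Lemma twist_biquandle : is_biquandle (twist finv circ) (twist finv ast).
Proof.
have bq := vbiq_biquandle hB.
have fc := finv_morph (vbiq_circ hB); have fa := finv_morph (vbiq_ast hB).
have finvB : bijective finv by exists f.
split.
- by move=> x; rewrite /twist (biq_diag bq).
- by move=> y; exact: bij_comp (biq_circ_bij bq (finv y)) finvB.
- by move=> y; exact: bij_comp (biq_ast_bij bq (finv y)) finvB.
- have finv2B : bijective (fun p : B * B => (finv p.1, finv p.2)).
    exists (fun p : B * B => (f p.1, f p.2)) => -[x y] /=; first by rewrite !finvK.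
    by rewrite !fK.
  exact: bij_comp (biq_swap_bij bq) finv2B.
- by move=> x y z; rewrite /twist !fc !fa (biq_circ_circ bq).
- by move=> x y z; rewrite /twist !fc !fa (biq_circ_ast bq).
- by move=> x y z; rewrite /twist !fc !fa (biq_ast_ast bq).
Qed.

(** The reason for the form of the twisted operations: the inverse of [f] in them
    absorbs the drop of the index, from [z + 1] on the two left parts at a
    crossing to [z] on the right parts. *)
Lemma fpow_twist (op : B -> B -> B) : (forall x y, f (op x y) = op (f x) (f y)) ->
  forall z x y, fpow f finv z (op x y) =
    twist finv op (fpow f finv (z + 1) x) (fpow f finv (z + 1) y).
Proof.
move=> fop z x y; rewrite /twist !fpowS// !fK fpow_morph//.
exact: finv_morph.
Qed.

End Twist.

(** * Colourings *)

Section Index.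
Context {R : realType} (D : vlink_diagram R).
Variables (W : R * R -> int) (nW : curve_numbering D W).

Lemma index_exists : exists idx : short_arc D -> int, forall a x,
  sval a x -> W (position x) = idx a.
Proof.
have [w hw] := choice (@arc_nonempty _ D predT).
exists (fun a => W (position (w a))) => a x ax.
apply: (arc_constant (F := fun x => W (position x)) _ _ (arc_same ax (hw a))).
  by move=> y z /position_same ->.
by move=> y yc; exact: numbering_uncut.
Qed.

Variables (idx : short_arc D -> int).
Hypothesis idxP : forall a x, sval a x -> W (position x) = idx a.

Lemma idx_after k b (a : short_arc D) : arc_after (strand k b) a ->
  idx a = W (crossing k) +
    ((0 < det2 (strand_velocity k (~~ b)) (strand_velocity k b))%R : nat)%:Z.
Proof.
move=> ha; have h : \forall s \near (strand k b).2^'+,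
    W (position ((strand k b).1, s)) = W (crossing k) +
    ((0 < det2 (strand_velocity k (~~ b)) (strand_velocity k b))%R : nat)%:Z.
  by apply: filterS (numbering_crossing nW k b) => s [].
have [s [as_ hs]] := @filter_ex _ _ (at_right_proper_filter _) _ (filterI ha h).
by rewrite -hs (idxP as_).
Qed.

Lemma idx_before k b (a : short_arc D) : arc_before (strand k b) a ->
  idx a = W (crossing k) +
    (~~ (0 < det2 (strand_velocity k (~~ b)) (strand_velocity k b))%R : nat)%:Z.
Proof.
move=> ha; have h : \forall s \near (strand k b).2^'-,
    W (position ((strand k b).1, s)) = W (crossing k) +
    (~~ (0 < det2 (strand_velocity k (~~ b)) (strand_velocity k b))%R : nat)%:Z.
  by apply: filterS (numbering_crossing nW k b) => s [].
have [s [as_ hs]] := @filter_ex _ _ (at_left_proper_filter _) _ (filterI ha h).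
by rewrite -hs (idxP as_).
Qed.

Lemma idx_left k b (a : short_arc D) : left_part k b a -> idx a = W (crossing k) + 1.
Proof.
rewrite /left_part; case: ifPn => [h /idx_after ->|h /idx_before ->].
  by rewrite h.
by rewrite h.
Qed.

Lemma idx_right k b (a : short_arc D) : right_part k b a -> idx a = W (crossing k).
Proof.
rewrite /right_part; case: ifPn => [h /idx_before ->|h /idx_after ->].
  by rewrite h addr0.
by rewrite (negbTE h) addr0.
Qed.

Lemma det2_swap_gt0 (k : 'I_(ncross D)) b :
  ~~ (0 < det2 (strand_velocity k (~~ b)) (strand_velocity k b)) =
  (0 < det2 (strand_velocity k b) (strand_velocity k (~~ b))).
Proof.
set u := strand_velocity k b; set v := strand_velocity k (~~ b).
have uv : det2 v u = - det2 u v by rewrite /det2; ring.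
have : det2 u v != 0.
  have := strand_transversal k; rewrite /u /v /strand_velocity; case: (b) => //=.
  apply: contra => /eqP d0; rewrite -oppr_eq0; apply/eqP.
  by rewrite -[RHS]d0 /det2; ring.
by rewrite uv oppr_gt0 -leNgt le_eqVlt eq_sym => /negbTE ->.
Qed.

(** The strand that crosses from right to left sees the strand [b] going from its
    left to its right, so that the index along [b] drops by one; in the other
    case it grows by one. *)
Lemma idx_across k b (a a' : short_arc D) :
  arc_before (strand k b) a -> arc_after (strand k b) a' ->
  if 0 < det2 (strand_velocity k b) (strand_velocity k (~~ b))
  then idx a = idx a' + 1 else idx a' = idx a + 1.
Proof.
move=> ba aa'; rewrite (idx_before ba) (idx_after aa') -det2_swap_gt0.
by case: (0 < _) => /=; rewrite addr0.
Qed.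

End Index.

Definition arc_within (R : realType) (D : vlink_diagram R) (a : short_arc D)
  (A : long_arc D) : Prop := exists2 x, sval a x & sval A x.

Section Within.
Context {R : realType} (D : vlink_diagram R).
Implicit Types (a : short_arc D) (A : long_arc D) (x : source_point D).

Lemma within_long_exists a : exists A, arc_within a A.
Proof.
have [x ax] := arc_nonempty a.
have [|A Ax] := @arc_through _ _ (@is_classical R D) x; last by exists A, x.
by move=> /is_cut_sub cut; apply: (arc_uncut ax); exact: cut.
Qed.

Lemma within_short_exists A : exists a, arc_within a A.
Proof.
have [x Ax] := arc_nonempty A.
have [a ha] := arc_after_exists predT x; exists a.
have [s [as_ As]] := @filter_ex _ _ (at_right_proper_filter _) _
  (filterI ha (arc_after_mem Ax)).
by exists (x.1, s).
Qed.

Lemma within_unique a A A' : arc_within a A -> arc_within a A' -> A = A'.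
Proof.
move=> [x ax Ax] [x' ax' A'x']; apply: arc_unique A'x'.
exact: arc_sub ax Ax ax'.
Qed.

Lemma within_after a A x : arc_after x a -> arc_within a A -> arc_after x A.
Proof. by move=> xa [y ay Ay]; apply: filterS xa => s; exact: arc_sub ay Ay. Qed.

Lemma within_before a A x : arc_before x a -> arc_within a A -> arc_before x A.
Proof. by move=> xa [y ay Ay]; apply: filterS xa => s; exact: arc_sub ay Ay. Qed.

Lemma after_within a A x : arc_after x a -> arc_after x A -> arc_within a A.
Proof.
move=> xa xA.
have [s [as_ As]] :=
  @filter_ex _ _ (at_right_proper_filter _) _ (filterI xa xA).
by exists (x.1, s).
Qed.

Lemma before_within a A x : arc_before x a -> arc_before x A -> arc_within a A.
Proof.
move=> xa xA.
have [s [as_ As]] :=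
  @filter_ex _ _ (at_left_proper_filter _) _ (filterI xa xA).
by exists (x.1, s).
Qed.

Lemma within_left_part k b a A : left_part k b a -> arc_within a A -> left_part k b A.
Proof.
by rewrite /left_part; case: ifP => _; [exact: within_after|exact: within_before].
Qed.

Lemma within_right_part k b a A :
  right_part k b a -> arc_within a A -> right_part k b A.
Proof.
by rewrite /right_part; case: ifP => _; [exact: within_before|exact: within_after].
Qed.

Lemma left_part_within k b A : left_part k b A ->
  exists2 a, left_part k b a & arc_within a A.
Proof.
rewrite /left_part; case: ifP => _ h.
  have [a ha] := arc_after_exists predT (strand k b).
  by exists a => //; exact: after_within ha h.
have [a ha] := arc_before_exists predT (strand k b).
by exists a => //; exact: before_within ha h.
Qed.

Lemma right_part_within k b A : right_part k b A ->
  exists2 a, right_part k b a & arc_within a A.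
Proof.
rewrite /right_part; case: ifP => _ h.
  have [a ha] := arc_before_exists predT (strand k b).
  by exists a => //; exact: before_within ha h.
have [a ha] := arc_after_exists predT (strand k b).
by exists a => //; exact: after_within ha h.
Qed.

(** A virtual crossing does not cut the long arc through it. *)
Lemma within_virtual k b a a' A : virtual k -> arc_before (strand k b) a ->
  arc_after (strand k b) a' -> arc_within a A -> arc_within a' A.
Proof.
move=> vk ba aa' aA.
have [|A' A'x] := @arc_through _ _ (@is_classical R D) (strand k b).
  by move=> [k' [b' [ck' /strand_inj[kk' _]]]]; move: ck'; rewrite kk' /is_classical vk.
have -> : A = A' := arc_before_unique (within_before ba aA) (arc_before_mem A'x).
exact: after_within aa' (arc_after_mem A'x).
Qed.

End Within.

Section Colourings.
Variables (B : Type) (circ ast : B -> B -> B) (f finv : B -> B).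
Hypothesis hB : is_virtual_biquandle circ ast f finv.
Context {R : realType} (D : vlink_diagram R).
Variables (W : R * R -> int) (nW : curve_numbering D W).
Variable idx : short_arc D -> int.
Hypothesis idxP : forall a x, sval a x -> W (position x) = idx a.

Let fK : cancel f finv := vbiq_fK hB.
Let finvK : cancel finv f := vbiq_finvK hB.

(** This removes the virtual rule from a colouring: at a virtual crossing the power
    of [f] changes by the inverse of what the virtual rule does to the colour. *)
Definition untwisted (c : short_arc D -> B) a := fpow f finv (idx a) (c a).

Lemma untwisted_virtual c k b a a' : virtual_rule f finv c -> virtual k ->
  arc_before (strand k b) a -> arc_after (strand k b) a' ->
  untwisted c a = untwisted c a'.
Proof.
move=> vc vk ba aa'; rewrite /untwisted (vc k vk b a a' ba aa').
have := idx_across nW idxP ba aa'; case: ifP => _ ->; rewrite fpowSr//.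
by rewrite finvK.
Qed.

(** The new colour is transported along the long arc through [F], the colour just
    after a point: unlike the colour at a point, it is defined at virtual
    crossings too, and there its local constancy is [untwisted_virtual]. *)
Lemma untwisted_long c a a' A : virtual_rule f finv c ->
  arc_within a A -> arc_within a' A -> untwisted c a = untwisted c a'.
Proof.
move=> vc [x ax Ax] [x' ax' Ax'].
have [aft haft] := choice (@arc_after_exists _ D predT).
pose F y := untwisted c (aft y).
have Fin b y : sval b y -> F y = untwisted c b.
  by move=> hb; rewrite /F (arc_after_unique (haft y) (arc_after_mem hb)).
rewrite -(Fin _ _ ax) -(Fin _ _ ax').
apply: (arc_constant _ _ (arc_same Ax Ax')) => y.
  by move=> z yz; rewrite /F (arc_after_unique (haft z) (arc_after_same yz (haft y))).
move=> yc.
have [bef hbef] := arc_before_exists predT y.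
have FB : untwisted c bef = F y.
  have [[k [b [_ ky]]]|yu] := pselect (is_cut predT y); last first.
    have [b yb] := arc_through yu.
    by rewrite (Fin _ _ yb) (arc_before_unique hbef (arc_before_mem yb)).
  have bk := arc_before_same (same_point_sym ky) hbef.
  have ak := arc_after_same (same_point_sym ky) (haft y).
  have vk : virtual k.
    by apply/negPn/negP => ck; apply: yc; exists k, b.
  exact: untwisted_virtual vc vk bk ak.
have hr : \forall s \near y.2, y.2 < s -> sval (aft y) (y.1, s) by exact: (haft y).
have hl : \forall s \near y.2, s < y.2 -> sval bef (y.1, s) by exact: hbef.
apply: filterS (filterI hr hl) => s [sr sl].
have [ys|ys|<-] := ltgtP y.2 s; last by rewrite -surjective_pairing.
  by rewrite (Fin _ _ (sr ys)).
by rewrite (Fin _ _ (sl ys)) FB.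
Qed.

Lemma untwisted_classical c a_l a_r b_l b_r k : classical_rule circ ast c ->
  is_classical k ->
  left_part k false a_l -> right_part k false a_r ->
  left_part k true b_l -> right_part k true b_r ->
  untwisted c a_r = twist finv circ (untwisted c a_l) (untwisted c b_l) /\
  untwisted c b_r = twist finv ast (untwisted c b_l) (untwisted c a_l).
Proof.
move=> cc kc al ar bl br; have [ce de] := cc k kc _ _ _ _ al ar bl br.
rewrite /untwisted ce de !(idx_left nW idxP al) !(idx_left nW idxP bl).
rewrite (idx_right nW idxP ar) (idx_right nW idxP br).
by split; [exact: (fpow_twist hB (vbiq_circ hB))|exact: (fpow_twist hB (vbiq_ast hB))].
Qed.

Definition retwisted (within : short_arc D -> long_arc D) (c : long_arc D -> B) a :=
  fpow finv f (idx a) (c (within a)).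

(** The inverse map takes the colour of the long arc around a short arc and
    multiplies the index back in. *)
Lemma colouring_bijection :
  exists phi : virtual_biquandle_colouring D circ ast f finv ->
               biquandle_colouring D (twist finv circ) (twist finv ast),
    bijective phi.
Proof.
have [long longP] := choice (@within_long_exists _ D).
have [short shortP] := choice (@within_short_exists _ D).
have longE a A : arc_within a A -> long a = A by exact: within_unique (longP a).
have phiP (c : virtual_biquandle_colouring D circ ast f finv) :
    classical_rule (twist finv circ) (twist finv ast) (untwisted (sval c) \o short).
  case: c => c [cc vc] /= k kc A_l A_r B_l B_r.
  move=> /left_part_within[a_l al al'] /right_part_within[a_r ar ar'].
  move=> /left_part_within[b_l bl bl'] /right_part_within[b_r br br'].
  have E a A : arc_within a A -> untwisted c (short A) = untwisted c a.
    by move=> aA; exact: untwisted_long vc (shortP A) aA.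
  rewrite /= (E _ _ al') (E _ _ ar') (E _ _ bl') (E _ _ br').
  exact: untwisted_classical cc kc al ar bl br.
have psiP (c : biquandle_colouring D (twist finv circ) (twist finv ast)) :
    classical_rule circ ast (retwisted long (sval c)) /\
    virtual_rule f finv (retwisted long (sval c)).
  case: c => c cc /=; split=> k kc.
    move=> a_l a_r b_l b_r al ar bl br.
    have retK a z : idx a = z -> fpow f finv z (retwisted long c a) = c (long a).
      by move=> <-; exact: fpowK.
    have [ce de] := cc k kc _ _ _ _ (within_left_part al (longP _))
      (within_right_part ar (longP _)) (within_left_part bl (longP _))
      (within_right_part br (longP _)).
    have [eal ear] := (retK _ _ (idx_left nW idxP al), retK _ _ (idx_right nW idxP ar)).
    have [ebl ebr] := (retK _ _ (idx_left nW idxP bl), retK _ _ (idx_right nW idxP br)).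
    split; apply: (can_inj (fpowK (W (crossing k)) fK finvK)).
      by rewrite (fpow_twist hB (vbiq_circ hB)) ear ce eal ebl.
    by rewrite (fpow_twist hB (vbiq_ast hB)) ebr de eal ebl.
  move=> b a a' ba aa'.
  rewrite /retwisted (longE a' (long a)).
    2: exact: within_virtual kc ba aa' (longP a).
  have := idx_across nW idxP ba aa'; case: ifP => _ ->; rewrite fpowS//.
pose phi c : biquandle_colouring D (twist finv circ) (twist finv ast) :=
  exist _ _ (phiP c).
pose psi c : virtual_biquandle_colouring D circ ast f finv := exist _ _ (psiP c).
exists phi, psi => c; apply: eq_sig_hprop => /=;
  try by move=> *; exact: Prop_irrelevance.
  apply/funext => a; rewrite /retwisted /=.
  case: c => c [cc vc] /=; rewrite (untwisted_long vc (shortP (long a)) (longP a)).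
  exact: fpowK.
apply/funext => A; rewrite /untwisted /retwisted /= (longE _ A (shortP A)).
exact: fpowK.
Qed.

End Colourings.

Theorem theorem2 (B : Type) (circ ast : B -> B -> B) (f finv : B -> B)
    (hB : is_virtual_biquandle circ ast f finv) :
  is_biquandle (twist finv circ) (twist finv ast) /\
  forall (R : realType) (D : vlink_diagram R),
    exists phi : virtual_biquandle_colouring D circ ast f finv ->
                 biquandle_colouring D (twist finv circ) (twist finv ast),
      bijective phi.
Proof.
split; first exact: (twist_biquandle hB).
move=> R D; have [W nW] := curve_numbering_exists D.
have [idx idxP] := index_exists nW.
exact: (colouring_bijection hB nW idxP).
Qed.
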